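(* Let $f\colon Y:=\operatorname{Spec}(S)\to X:=\operatorname{Spec}(R)$ be a finite birational morphism of integral Noetherian schemes. If $\mathbf{R}f_\ast\mathcal{O}_Y\in\operatorname{Perf}(X)$, then the unit $\mathcal{O}_X\to\mathbf{R}f_\ast\mathcal{O}_Y$ is an isomorphism.
   Context: $\operatorname{Perf}(X)$ denotes the category of perfect complexes on $X$, a strictly full subcategory of the derived category $D_{\operatorname{qc}}(X)$ of complexes of $\mathcal{O}_X$-modules with quasi-coherent cohomology sheaves. The unit is the canonical morphism $\mathcal{O}_X\to\mathbf{R}f_\ast\mathbf{L}f^\ast\mathcal{O}_X\cong\mathbf{R}f_\ast\mathcal{O}_Y$ coming from the adjunction between $\mathbf{L}f^\ast$ and $\mathbf{R}f_\ast$. *)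

(* Defs.v *)
From HB Require Import structures.
From mathcomp Require Import all_boot all_order all_algebra.
From mathcomp Require Import ring_quotient.
From mathcomp Require Import all_classical.
From mathcomp Require Import topology.

Set Implicit Arguments.
Unset Strict Implicit.
Unset Printing Implicit Defensive.

Import Order.TTheory GRing.Theory Num.Theory.

Local Open Scope classical_set_scope.
Local Open Scope ring_scope.

Section Opens.
Variable T : topologicalType.

Record opens := Opens { oset :> set T; oopen : open oset }.

Definition osub (V U : opens) : Prop := (V : set T) `<=` U.

Definition opensI (U V : opens) : opens :=
  Opens (openI (oopen U) (oopen V)).

Record is_sheaf (F : opens -> Type)
    (res : forall U V, osub V U -> F U -> F V) : Prop := IsSheaf {
  sheaf_id : forall U (h : osub U U) x, res U U h x = x;
  sheaf_comp : forall U V W (h : osub V U) (k : osub W V) (l : osub W U) x,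
    res V W k (res U V h x) = res U W l x;
  sheaf_glue : forall (J : Type) (V : J -> opens) (U : opens)
      (h : forall j, osub (V j) U),
    (forall p, oset U p -> exists j, oset (V j) p) ->
    forall s : forall j, F (V j),
    (forall j k W (a : osub W (V j)) (b : osub W (V k)),
      res _ _ a (s j) = res _ _ b (s k)) ->
    exists! x : F U, forall j, res _ _ (h j) x = s j }.

End Opens.

Lemma opre_open (S T : topologicalType) (f : S -> T)
  (cf : continuous f) (U : opens T) : open (f @^-1` U).
Proof. by move/continuousP: cf; apply; exact: oopen. Qed.

Definition opre (S T : topologicalType) (f : S -> T) (cf : continuous f)
  (U : opens T) : opens S := Opens (opre_open cf U).

Lemma oimg_open (T : topologicalType) (U : opens T)
  (W : opens (set_type U)) : open (set_val @` (W : set (set_type U)) : set T).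
Proof.
case: W => W /= [V oV <-].
have -> : set_val @` (set_val @^-1` V : set (set_type U)) = V `&` U :> set T.
  apply/seteqP; split=> [_ [x Vx <-]|x [Vx Ux]].
    by split=> //; exact: set_valP.
  by exists (SigSub (mem_set Ux)).
by apply: openI => //; exact: oopen.
Qed.

Definition oimg (T : topologicalType) (U : opens T) (W : opens (set_type U)) :
  opens T := Opens (oimg_open W).

Section Oimg.
Variables (T : topologicalType) (U : opens T).

Lemma oimg_sub (V W : opens (set_type U)) : osub V W -> osub (oimg V) (oimg W).
Proof. by move=> h _ [x Vx <-]; exists x => //; exact: h. Qed.

Lemma sheaf_oimg (F : opens T -> Type)
    (res : forall V W, osub W V -> F V -> F W) :
  is_sheaf res ->
  is_sheaf (fun (V W : opens (set_type U)) (h : osub W V) =>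
    res (oimg V) (oimg W) (oimg_sub h)).
Proof.
move=> [rid rcomp rglue]; split=> [V h x|V W Z h k l x|]; [exact: rid|exact: rcomp|].
move=> J V W h cov s comp; apply: rglue.
  by move=> _ [p Wp <-]; have [j Vj] := cov p Wp; exists j; exists p.
move=> j k Z a b.
have cv : continuous (set_val : set_type U -> T) by exact: initial_continuous.
have ZU : osub Z (oimg (opre cv Z)).
  by move=> p Zp; have [x Vx xp] := a p Zp; exists x => //=; rewrite /preimage /= xp.
have aj : osub (opre cv Z) (V j).
  move=> x Zx; have [y Vy yx] := a _ Zx.
  by have <- : y = x by exact: val_inj.
have bk : osub (opre cv Z) (V k).
  move=> x Zx; have [y Vy yx] := b _ Zx.
  by have <- : y = x by exact: val_inj.
by rewrite -(rcomp _ _ _ (oimg_sub aj) ZU) -(rcomp _ _ _ (oimg_sub bk) ZU) (comp _ _ _ aj bk).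
Qed.

End Oimg.

Section Opre.
Variables (S T : topologicalType) (f : S -> T) (cf : continuous f).

Lemma opre_sub (U V : opens T) : osub V U -> osub (opre cf V) (opre cf U).
Proof. by move=> h p; exact: h. Qed.

Lemma sheaf_opre (F : opens S -> Type)
    (res : forall V W, osub W V -> F V -> F W) :
  is_sheaf res ->
  is_sheaf (fun (V W : opens T) (h : osub W V) =>
    res (opre cf V) (opre cf W) (opre_sub h)).
Proof.
move=> [rid rcomp rglue]; split=> [V h x|V W Z h k l x|]; [exact: rid|exact: rcomp|].
move=> J V U h cov s comp; apply: rglue; first by move=> p /cov.
move=> j k Z a b.
have ZI : osub Z (opre cf (opensI (V j) (V k))).
  by move=> p Zp; split; [exact: a|exact: b].
have aj : osub (opensI (V j) (V k)) (V j) by move=> ? [].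
have bk : osub (opensI (V j) (V k)) (V k) by move=> ? [].
by rewrite -(rcomp _ _ _ (opre_sub aj) ZI) -(rcomp _ _ _ (opre_sub bk) ZI) (comp _ _ _ aj bk).
Qed.

End Opre.

(* The rings of sections may be zero, as they must be over the empty set. *)
Record ringedSpace := RingedSpace {
  rs_top :> topologicalType;
  rs_sec : opens rs_top -> comPzRingType;
  rs_res : forall U V, osub V U -> {rmorphism rs_sec U -> rs_sec V};
  rs_sheaf : is_sheaf (fun U V (h : osub V U) => rs_res h) }.

Notation "'\O_' X" := (@rs_sec X) (at level 8, X at level 2, format "'\O_' X").

Definition rs_restrict (X : ringedSpace) (U : opens X) : ringedSpace :=
  @RingedSpace (set_type U) (fun W => \O_X (oimg W))
    (fun V W h => rs_res (oimg_sub h)) (sheaf_oimg U (@rs_sheaf X)).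

Record rsMorphism (Y X : ringedSpace) := RSMorphism {
  rs_fun :> Y -> X;
  rs_cont : continuous rs_fun;
  rs_sharp : forall U : opens X, {rmorphism \O_X U -> \O_Y (opre rs_cont U)};
  rs_sharp_nat : forall U V (h : osub V U) s,
    rs_sharp V (rs_res h s) = rs_res (opre_sub (cf := rs_cont) h) (rs_sharp U s) }.

Arguments rs_cont {Y X} r.

Record omod (X : ringedSpace) := OMod {
  osec :> forall U : opens X, lmodType (\O_X U);
  ores : forall U V, osub V U -> osec U -> osec V;
  ores_linear : forall U V (h : osub V U) a x y,
    ores h (a *: x + y) = rs_res h a *: ores h x + ores h y;
  omod_sheaf : is_sheaf ores }.

Record ohom (X : ringedSpace) (M N : omod X) := OHom {
  ohom_fun :> forall U : opens X, {linear M U -> N U};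
  ohom_nat : forall U V (h : osub V U) x,
    ohom_fun V (ores h x) = ores h (ohom_fun U x) }.

Section OMod.
Variable X : ringedSpace.
Implicit Types (M N P : omod X) (U : opens X).

Lemma ores0 M U V (h : osub V U) : ores h (0 : M U) = 0.
Proof.
apply: (@addrI _ (ores h (0 : M U))); rewrite addr0.
by have := ores_linear h 1 (0 : M U) 0; rewrite rmorph1 !scale1r addr0.
Qed.

Definition is_zero M := forall U (x : M U), x = 0.

Definition ohom_zero M N : ohom M N :=
  @OHom X M N (fun U => \0 : {linear M U -> N U})
    (fun U V h x => esym (ores0 N h)).

Lemma ohom_comp_nat M N P (g : ohom N P) (f : ohom M N) U V (h : osub V U)
  (x : M U) : g V (f V (ores h x)) = ores h (g U (f U x)).
Proof. by rewrite !ohom_nat. Qed.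

Definition ohom_comp M N P (g : ohom N P) (f : ohom M N) : ohom M P :=
  @OHom X M P (fun U => g U \o f U : {linear M U -> P U}) (ohom_comp_nat g f).

Definition oinjective (I : omod X) := forall (A B : omod X) (m : ohom A B),
  (forall U, injective (m U)) ->
  forall u : ohom A I, exists v : ohom B I, forall U x, v U (m U x) = u U x.

Definition direct_summand M N := exists (i : ohom M N) (p : ohom N M),
  forall U x, p U (i U x) = x.

End OMod.

Definition restr_scalars (A B : pzRingType) (g : {rmorphism A -> B})
  (M : lmodType B) : Type := M.

Section RestrScalars.
Variables (A B : pzRingType) (g : {rmorphism A -> B}) (M : lmodType B).
Local Notation RM := (restr_scalars g M).

HB.instance Definition _ := GRing.Zmodule.on RM.

Definition restr_scale (a : A) (x : RM) : RM := g a *: (x : M).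

Lemma restr_scaleA a b x : restr_scale a (restr_scale b x) = restr_scale (a * b) x.
Proof. by rewrite /restr_scale scalerA rmorphM. Qed.
Lemma restr_scale1 : left_id 1 restr_scale.
Proof. by move=> x; rewrite /restr_scale rmorph1 scale1r. Qed.
Lemma restr_scaleDr : right_distributive restr_scale +%R.
Proof. by move=> a x y; rewrite /restr_scale scalerDr. Qed.
Lemma restr_scaleDl x : {morph restr_scale^~ x : a b / a + b}.
Proof. by move=> a b; rewrite /restr_scale rmorphD scalerDl. Qed.

HB.instance Definition _ := GRing.Zmodule_isLmodule.Build A RM
  restr_scaleA restr_scale1 restr_scaleDr restr_scaleDl.

End RestrScalars.

Section PushModule.
Variables (Y X : ringedSpace) (f : rsMorphism Y X).

Definition push_sec (M : omod Y) (U : opens X) : lmodType (\O_X U) :=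
  restr_scalars (rs_sharp f U) (M (opre (rs_cont f) U)).

Definition push_res (M : omod Y) U V (h : osub V U) :
  push_sec M U -> push_sec M V :=
  @ores _ M _ _ (opre_sub (cf := rs_cont f) h).

Lemma push_res_linear M U V (h : osub V U) a (x y : push_sec M U) :
  push_res h (a *: x + y) = rs_res h a *: push_res h x + push_res h y.
Proof.
rewrite /push_res [LHS](@ores_linear _ M _ _ _ (rs_sharp f U a) x y).
by rewrite -rs_sharp_nat.
Qed.

Definition push_mod (M : omod Y) : omod X :=
  OMod (@push_res_linear M) (sheaf_opre (rs_cont f) (omod_sheaf M)).

Lemma push_hom_linear M N (g : ohom M N) (U : opens X) :
  linear (g (opre (rs_cont f) U) : push_mod M U -> push_mod N U).
Proof. by move=> a x y; exact: (linearP (g (opre (rs_cont f) U))). Qed.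

HB.instance Definition _ M N (g : ohom M N) (U : opens X) :=
  GRing.isLinear.Build (\O_X U) (push_mod M U) (push_mod N U) _
    (g (opre (rs_cont f) U) : push_mod M U -> push_mod N U) (@push_hom_linear M N g U).

Definition push_hom M N (g : ohom M N) : ohom (push_mod M) (push_mod N) :=
  @OHom X (push_mod M) (push_mod N)
    (fun U => (g (opre (rs_cont f) U) : push_mod M U -> push_mod N U))
    (fun U V h x => ohom_nat g (opre_sub h) x).

End PushModule.

Section RestrictModule.
Variables (X : ringedSpace) (U : opens X).

Definition restrict_mod (M : omod X) : omod (rs_restrict U) :=
  @OMod (rs_restrict U) (fun W => M (oimg W))
    (fun V W h => ores (oimg_sub h)) (fun V W h => ores_linear (oimg_sub h))
    (sheaf_oimg U (omod_sheaf M)).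

Definition restrict_hom M N (g : ohom M N) : ohom (restrict_mod M) (restrict_mod N) :=
  @OHom (rs_restrict U) (restrict_mod M) (restrict_mod N) (fun W => g (oimg W))
    (fun V W h => ohom_nat g (oimg_sub h)).

End RestrictModule.

Section StructureModules.
Variable X : ringedSpace.

Definition structure_mod : omod X :=
  @OMod X (fun U => (\O_X U)^o) (fun U V h => rs_res h)
    (fun U V h a x y => etrans (rmorphD _ _ _) (congr1 (+%R^~ _) (rmorphM _ _ _)))
    (@rs_sheaf X).

Definition free_res n U V (h : osub V U) :
  'rV[\O_X U]_n -> 'rV[\O_X V]_n := map_mx (rs_res h).

Lemma free_res_linear n U V (h : osub V U) a (x y : 'rV[\O_X U]_n) :
  free_res h (a *: x + y) = rs_res h a *: free_res h x + free_res h y.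
Proof. by apply/rowP => i; rewrite !mxE rmorphD rmorphM. Qed.

Lemma free_sheaf n : is_sheaf (@free_res n).
Proof.
have [rid rcomp rglue] := @rs_sheaf X.
split=> [U h x|U V W h k l x|J V U h cov s comp].
- by apply/rowP => i; rewrite !mxE; exact: rid.
- by apply/rowP => i; rewrite !mxE; exact: rcomp.
have glue i : exists! x, forall j, rs_res (h j) x = s j 0 i.
  apply: rglue => // j k W a b.
  by have /rowP/(_ i) := comp j k W a b; rewrite !mxE.
have [t tP] := choice glue.
exists (\row_i t i); split=> [j|y yP].
  by apply/rowP => i; rewrite !mxE; exact: (tP i).1.
apply/rowP => i; rewrite mxE; apply: (tP i).2 => j.
by rewrite -(yP j) mxE.
Qed.

Definition free_mod n : omod X :=
  @OMod X (fun U => 'rV[\O_X U]_n) (@free_res n) (@free_res_linear n)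
    (free_sheaf n).

End StructureModules.

Section SharpHom.
Variables (Y X : ringedSpace) (f : rsMorphism Y X).
Local Notation sharp U :=
  (rs_sharp f U : structure_mod X U -> push_mod f (structure_mod Y) U).

Lemma sharp_linear (U : opens X) : linear (sharp U).
Proof.
move=> a x y.
exact: etrans (rmorphD _ _ _) (congr1 (+%R^~ _) (rmorphM _ _ _)).
Qed.

HB.instance Definition _ (U : opens X) :=
  GRing.isLinear.Build (\O_X U) (structure_mod X U)
    (push_mod f (structure_mod Y) U) _ (sharp U) (@sharp_linear U).

Definition sharp_hom : ohom (structure_mod X) (push_mod f (structure_mod Y)) :=
  @OHom X (structure_mod X) (push_mod f (structure_mod Y)) (fun U => sharp U)
    (fun U V h s => rs_sharp_nat f h s).

End SharpHom.

Record complex (X : ringedSpace) := Complex {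
  cobj :> int -> omod X;
  cdiff : forall i, ohom (cobj i) (cobj (i + 1));
  cdiffK : forall i U (x : cobj i U), cdiff (i + 1) U (cdiff i U x) = 0 }.

Record chainMap (X : ringedSpace) (M N : complex X) := ChainMap {
  chain_fun :> forall i, ohom (M i) (N i);
  chain_nat : forall i U (x : M i U),
    chain_fun (i + 1) U (cdiff M i U x) = cdiff N i U (chain_fun i U x) }.

Section Complexes.
Variable X : ringedSpace.
Implicit Types (M N P I : complex X).

Lemma chain_comp_nat M N P (g : chainMap N P) (f : chainMap M N) i U
  (x : M i U) : g (i + 1) U (f (i + 1) U (cdiff M i U x)) =
                cdiff P i U (g i U (f i U x)).
Proof. by rewrite !chain_nat. Qed.

Definition chain_comp M N P (g : chainMap N P) (f : chainMap M N) :
  chainMap M P := @ChainMap X M P (fun i => ohom_comp (g i) (f i))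
    (chain_comp_nat g f).

(* The morphism of cohomology sheaves H^(i+1)(M) -> H^(i+1)(N) is injective,
   resp. surjective.  Cohomology sheaves are the sheafifications of
   cocycles modulo coboundaries, so a section of them vanishes, resp. lifts,
   as soon as it does so locally.  Every integer has the form i + 1. *)
Definition coh_injective M N (f : chainMap M N) (i : int) :=
  forall U (x : M (i + 1) U) (y : N i U),
    cdiff M (i + 1) U x = 0 -> f (i + 1) U x = cdiff N i U y ->
    forall p, oset U p -> exists (W : opens X) (h : osub W U) (z : M i W),
      oset W p /\ ores h x = cdiff M i W z.

Definition coh_surjective M N (f : chainMap M N) (i : int) :=
  forall U (y : N (i + 1) U), cdiff N (i + 1) U y = 0 ->
    forall p, oset U p -> exists (W : opens X) (h : osub W U)
      (x : M (i + 1) W) (z : N i W),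
      [/\ oset W p, cdiff M (i + 1) W x = 0 &
          ores h y = f (i + 1) W x + cdiff N i W z].

Definition quasi_iso M N (f : chainMap M N) :=
  forall i, coh_injective f i /\ coh_surjective f i.

Definition strictly_perfect M :=
  (exists a b : int, forall i, (i < a) || (b < i) -> is_zero (M i)) /\
  (forall i, exists n, direct_summand (M i) (free_mod X n)).

Definition injective_resolution M I (r : chainMap M I) :=
  [/\ quasi_iso r, forall i, oinjective (I i) &
      exists a : int, forall i, i < a -> is_zero (I i)].

Definition single_obj (F : omod X) (i : int) : omod X :=
  match i with Posz 0 => F | _ => free_mod X 0 end.

Definition single (F : omod X) : complex X :=
  @Complex X (single_obj F) (fun i => ohom_zero _ _) (fun i U x => erefl).

End Complexes.

Definition restrict_complex (X : ringedSpace) (U : opens X) (M : complex X) :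
  complex (rs_restrict U) :=
  @Complex (rs_restrict U) (fun i => restrict_mod U (M i))
    (fun i => restrict_hom U (cdiff M i)) (fun i W x => @cdiffK X M i (oimg W) x).

(* Locally isomorphic to a strictly perfect complex F; an isomorphism in the
   derived category of O_U-modules is a roof M|U <- G -> F of
   quasi-isomorphisms. *)
Definition perfect (X : ringedSpace) (M : complex X) :=
  forall p : X, exists2 U : opens X, oset U p &
    exists (F G : complex (rs_restrict U))
      (s : chainMap G (restrict_complex U M)) (t : chainMap G F),
      [/\ strictly_perfect F, quasi_iso s & quasi_iso t].

Section PushComplex.
Variables (Y X : ringedSpace) (f : rsMorphism Y X).

Definition push_complex (M : complex Y) : complex X :=
  @Complex X (fun i => push_mod f (M i)) (fun i => push_hom f (cdiff M i))
    (fun i U x => @cdiffK Y M i (opre (rs_cont f) U) x).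

Definition push_chain (M N : complex Y) (g : chainMap M N) :
  chainMap (push_complex M) (push_complex N) :=
  @ChainMap X (push_complex M) (push_complex N) (fun i => push_hom f (g i))
    (fun i U x => @chain_nat Y M N g i (opre (rs_cont f) U) x).

Definition sharp_single_fun (i : int) :
  ohom (single (structure_mod X) i) (push_complex (single (structure_mod Y)) i) :=
  match i with Posz 0 => sharp_hom f | _ => ohom_zero _ _ end.

Lemma sharp_single_nat i U (x : single (structure_mod X) i U) :
  sharp_single_fun (i + 1) U (cdiff (single (structure_mod X)) i U x) =
  cdiff (push_complex (single (structure_mod Y))) i U (sharp_single_fun i U x).
Proof. exact: linear0. Qed.

Definition sharp_single : chainMap (single (structure_mod X))
    (push_complex (single (structure_mod Y))) := ChainMap sharp_single_nat.

(* When r : O_Y -> I is an injective resolution, push_complex I is Rf_* O_Y.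
   Since O_X is flat over itself, Lf^* O_X = f^* O_X = O_Y, so the adjunction
   unit at O_X is the morphism O_X -> f_* I adjoint to r : f^* O_X -> I, which
   is O_X -> f_* O_Y -> f_* I. *)
Definition derived_unit (I : complex Y)
  (r : chainMap (single (structure_mod Y)) I) :
  chainMap (single (structure_mod X)) (push_complex I) :=
  chain_comp (push_chain r) sharp_single.

End PushComplex.

Section Spectrum.
Variable R : comNzRingType.

Record spec := Spec {
  spec_pred :> {pred R};
  spec_ideal : idealr_closed spec_pred;
  spec_prime : prime_idealr_closed spec_pred }.
Arguments spec_prime s : clear implicits.

HB.instance Definition _ := gen_eqMixin spec.
HB.instance Definition _ := gen_choiceMixin spec.

Definition zariski_open (U : set spec) :=
  exists A : set R, U = [set p : spec | exists2 a, A a & a \notin p].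

Lemma zariski_openT : zariski_open setT.
Proof.
exists setT; apply/seteqP; split=> // p _; exists 1 => //.
by have [] := spec_ideal p.
Qed.

Lemma spec_primeM (p : spec) a b : a \notin p -> b \notin p -> a * b \notin p.
Proof. by move=> ap bp; apply/negP => /(spec_prime p); rewrite (negPf ap) (negPf bp). Qed.

Lemma spec_idealM (p : spec) a b : b \in p -> a * b \in p.
Proof.
by move=> bp; have [p0 _ /(_ a b 0 bp p0)] := spec_ideal p; rewrite addr0.
Qed.

Lemma spec_notinM (p : spec) a b :
  (a * b \notin p) = (a \notin p) && (b \notin p).
Proof.
apply/idP/andP => [abp|[ap bp]]; last exact: spec_primeM.
by split; apply: contra abp => ?; [rewrite mulrC|]; exact: spec_idealM.
Qed.

Lemma zariski_openI : setI_closed zariski_open.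
Proof.
move=> _ _ [A ->] [B ->].
exists [set c | exists a b, [/\ A a, B b & c = a * b]].
apply/seteqP; split=> p /=.
  move=> [[a Aa ap] [b Bb bp]]; exists (a * b); last exact: spec_primeM.
  by exists a, b.
move=> [_ [a [b [Aa Bb ->]]]]; rewrite spec_notinM => /andP[ap bp].
by split; [exists a|exists b].
Qed.

Lemma zariski_open_bigcup (I : Type) (F : I -> set spec) :
  (forall i, zariski_open (F i)) -> zariski_open (\bigcup_i F i).
Proof.
move=> /choice[A FA]; exists (\bigcup_i A i); apply/seteqP; split=> p /=.
  by move=> [i _]; rewrite FA => -[a Aa ap]; exists a => //; exists i.
by move=> [a [i _ Aa] ap]; exists i => //; rewrite FA; exists a.
Qed.

HB.instance Definition _ := isOpenTopological.Build spec
  zariski_openT zariski_openI zariski_open_bigcup.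

End Spectrum.
Arguments spec_prime {R} s [u v].

Section SpecMap.
Variables (R S : comNzRingType) (phi : {rmorphism R -> S}).

Lemma spec_comap_ideal (q : spec S) : idealr_closed [pred a | phi a \in q].
Proof.
have [q0 q1 qD] := spec_ideal q; split; rewrite ?inE ?rmorph0 ?rmorph1 //.
by move=> a u v uq vq; rewrite inE rmorphD rmorphM; exact: qD.
Qed.

Lemma spec_comap_prime (q : spec S) : prime_idealr_closed [pred a | phi a \in q].
Proof. by move=> a b; rewrite !inE rmorphM => /(spec_prime q). Qed.

Definition spec_comap (q : spec S) : spec R :=
  Spec (@spec_comap_ideal q) (@spec_comap_prime q).

Lemma spec_comap_continuous : continuous spec_comap.
Proof.
apply/continuousP => _ [A ->].
exists (phi @` A); apply/seteqP; split=> q /=.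
  by move=> [a Aa aq]; exists (phi a) => //; exists a.
by move=> [_ [a Aa <-] aq]; exists a.
Qed.

End SpecMap.

Notation "x %:F" := (@FracField.tofrac _ x) : ring_scope.

Lemma spec_den_neq0 (R : idomainType) (p : spec R) (b : R) :
  b \notin p -> b%:F != 0.
Proof.
move=> bp; rewrite tofrac_eq0; apply: contraNneq bp => ->.
by have [] := spec_ideal p.
Qed.

Section StructureSheaf.
Variable R : idomainType.
Local Notation K := {fraction R}.

(* As R is a domain, all its localizations R_p are subrings of its fraction
   field.  A section over U is a function that is locally a fraction a / b with
   b outside of the primes considered; in particular its value at p lies in
   R_p. *)
Definition locally_fraction (U : opens (spec R)) (s : U -> K) :=
  forall p : U, exists2 V : opens (spec R), oset V (val p) &
    exists a b : R, forall q : U, oset V (val q) ->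
      b \notin val q /\ s q = a%:F / b%:F.

Definition regular (U : opens (spec R)) : {pred U -> K} :=
  fun s => `[< locally_fraction s >].

Lemma regular_subring U : subring_closed (@regular U).
Proof.
split.
- apply/asboolP => p; exists (Opens openT) => //; exists 1, 1 => q _.
  by have [_ q1 _] := spec_ideal (val q); rewrite tofrac1 divr1.
- move=> s t /asboolP sU /asboolP tU; apply/asboolP => p.
  have [V Vp [a [b sV]]] := sU p; have [W Wp [c [d tW]]] := tU p.
  exists (opensI V W) => //; exists (a * d - c * b), (b * d) => q [Vq Wq].
  have [bq sq] := sV q Vq; have [dq tq] := tW q Wq; split.
    exact: spec_primeM.
  have b0 := spec_den_neq0 bq; have d0 := spec_den_neq0 dq.
  suff: s q - t q = (a * d - c * b)%:F / (b * d)%:F :> K by [].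
  by rewrite sq tq -mulNr addf_div // tofracB !tofracM mulNr.
- move=> s t /asboolP sU /asboolP tU; apply/asboolP => p.
  have [V Vp [a [b sV]]] := sU p; have [W Wp [c [d tW]]] := tU p.
  exists (opensI V W) => //; exists (a * c), (b * d) => q [Vq Wq].
  have [bq sq] := sV q Vq; have [dq tq] := tW q Wq; split.
    exact: spec_primeM.
  suff: s q * t q = (a * c)%:F / (b * d)%:F :> K by [].
  by rewrite sq tq !tofracM invfM mulrACA.
Qed.

Record spec_sec (U : opens (spec R)) := SpecSec {
  spec_val :> U -> K;
  spec_valP : spec_val \in @regular U }.

HB.instance Definition _ (U : opens (spec R)) := [isSub for (@spec_val U)].
HB.instance Definition _ (U : opens (spec R)) := [Choice of (spec_sec U) by <:].
HB.instance Definition _ (U : opens (spec R)) :=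
  GRing.SubChoice_isSubComPzRing.Build (U -> K) (@regular U) (spec_sec U)
    (@regular_subring U).

Definition oincl (U V : opens (spec R)) (h : osub V U) (p : V) : U :=
  SigSub (mem_set (h _ (set_valP p))).

Lemma spec_res_regular U V (h : osub V U) (s : spec_sec U) :
  (fun p => s (oincl h p)) \in @regular V.
Proof.
apply/asboolP => p; have /asboolP/(_ (oincl h p))[W Wp [a [b sW]]] := spec_valP s.
by exists W => //; exists a, b => q Wq; exact: (sW (oincl h q)).
Qed.

Definition spec_res U V (h : osub V U) (s : spec_sec U) : spec_sec V :=
  SpecSec (spec_res_regular h s).

Lemma spec_res_zmod U V (h : osub V U) : zmod_morphism (spec_res h).
Proof. by move=> s t; apply: val_inj; apply/funext. Qed.

Lemma spec_res_monoid U V (h : osub V U) : monoid_morphism (spec_res h).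
Proof. by split=> [|s t]; apply: val_inj; apply/funext. Qed.

HB.instance Definition _ (U V : opens (spec R)) (h : osub V U) :=
  GRing.isZmodMorphism.Build (spec_sec U) (spec_sec V) (spec_res h)
    (spec_res_zmod h).
HB.instance Definition _ (U V : opens (spec R)) (h : osub V U) :=
  GRing.isMonoidMorphism.Build (spec_sec U) (spec_sec V) (spec_res h)
    (spec_res_monoid h).

Lemma spec_sheaf :
  is_sheaf (fun U V (h : osub V U) => spec_res h : spec_sec U -> spec_sec V).
Proof.
have ext (U : opens (spec R)) (s : spec_sec U) (p q : U) :
  val p = val q -> s p = s q by move=> pq; congr (s _); exact: val_inj.
split=> [U h s|U V W h k l s|J V U h cov s comp].
- by apply: val_inj; apply/funext => p; exact: (ext U s).
- by apply: val_inj; apply/funext => p; exact: (ext U s).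
have mem (p : U) : exists j : {j | oset (V j) (val p)}, True.
  by have [j Vj] := cov _ (set_valP p); exists (exist _ j Vj).
pose idx p := projT1 (cid (mem p)).
pose pt (p : U) : V (projT1 (idx p)) :=
    SigSub (mem_set (projT2 (idx p) : oset (V (projT1 (idx p))) (val p))).
pose t p := s _ (pt p).
have tE j (q : V j) (p : U) : val p = val q -> t p = s j q.
  move=> pq; pose W := opensI (V (projT1 (idx p))) (V j).
  have a : osub W (V (projT1 (idx p))) by move=> ? [].
  have b : osub W (V j) by move=> ? [].
  have Wp : oset W (val p) by split; [exact: (projT2 (idx p))|rewrite pq; exact: set_valP].
  have /(congr1 (fun u : spec_sec W => u (SigSub (mem_set Wp)))) := comp _ _ W a b.
  rewrite /= => E; apply: etrans (etrans E _); exact: ext.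
have tU : t \in @regular U.
  apply/asboolP => p; have [j Vj] := cov _ (set_valP p).
  have /asboolP/(_ (SigSub (mem_set Vj)))[W Wp [a [b sW]]] := spec_valP (s j).
  exists (opensI W (V j)); first by split.
  exists a, b => q [Wq Vq]; have [bq sq] := sW (SigSub (mem_set Vq)) Wq.
  by split=> //; rewrite -sq; exact: tE.
exists (SpecSec tU); split=> [j|u uP].
  by apply: val_inj; apply/funext => p; exact: tE.
apply: val_inj; apply/funext => p; have [j Vj] := cov _ (set_valP p).
rewrite /= (tE j (SigSub (mem_set Vj)) p) // -(uP j) /=; exact: ext.
Qed.

Definition Spec_rs : ringedSpace := @RingedSpace (spec R) spec_sec
  (fun U V h => spec_res h) spec_sheaf.

End StructureSheaf.

Section SpecMorphism.
Variables (R S : idomainType) (phi : {rmorphism R -> S}).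

(* The homomorphism R_p -> S_q induced by phi, for p = phi^-1 q, sending a / b to
   phi a / phi b, extended by 0 to the elements of {fraction R} outside R_p. *)
Definition local_map (q : spec S) (z : {fraction R}) : {fraction S} :=
  xget 0 [set w | exists a b, [/\ phi b \notin q, z = a%:F / b%:F &
                                 w = (phi a)%:F / (phi b)%:F]].

Lemma local_mapE (q : spec S) a b : phi b \notin q ->
  local_map q (a%:F / b%:F) = (phi a)%:F / (phi b)%:F.
Proof.
move=> bq; rewrite /local_map; case: xgetP => [_ _ [c [d [dq E ->]]]|/(_ _)]; last first.
  by move=> /(_ ((phi a)%:F / (phi b)%:F))[]; exists a, b.
have b0 := spec_den_neq0 (bq : b \notin spec_comap phi q).
have d0 := spec_den_neq0 (dq : d \notin spec_comap phi q).
have pb0 := spec_den_neq0 bq; have pd0 := spec_den_neq0 dq.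
move/eqP: E; rewrite eqr_div // -!tofracM tofrac_eq => /eqP E.
by apply/eqP; rewrite eqr_div // -!tofracM tofrac_eq -!rmorphM -E.
Qed.

Let comap_cont := @spec_comap_continuous R S phi.

Definition comap_pt (U : opens (spec R)) (q : opre comap_cont U) : U :=
  SigSub (mem_set (set_valP q : oset U (spec_comap phi (val q)))).

Definition spec_sharp_fun U (s : spec_sec U) (q : opre comap_cont U) :=
  local_map (val q) (s (comap_pt q)).

Lemma spec_sharp_local U (s : spec_sec U) (q : opre comap_cont U) :
  exists2 V : opens (spec R), oset V (spec_comap phi (val q)) &
  exists a b, forall r : opre comap_cont U, oset V (spec_comap phi (val r)) ->
    [/\ phi b \notin val r, s (comap_pt r) = a%:F / b%:F &
        spec_sharp_fun s r = (phi a)%:F / (phi b)%:F].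
Proof.
have /asboolP/(_ (comap_pt q))[V Vq [a [b sV]]] := spec_valP s.
exists V => //; exists a, b => r Vr; have [br sr] := sV (comap_pt r) Vr.
by split=> //; rewrite /spec_sharp_fun sr local_mapE.
Qed.

Lemma spec_sharp_regular U (s : spec_sec U) :
  spec_sharp_fun s \in @regular S (opre comap_cont U).
Proof.
apply/asboolP => q; have [V Vq [a [b sV]]] := spec_sharp_local s q.
by exists (opre comap_cont V) => //; exists (phi a), (phi b) => r /sV[].
Qed.

Definition spec_sharp U (s : spec_sec U) : spec_sec (opre comap_cont U) :=
  SpecSec (spec_sharp_regular s).

Lemma spec_sharp_zmod U : zmod_morphism (@spec_sharp U).
Proof.
move=> s t; apply: val_inj; apply/funext => q.
have [V Vq [a [b /(_ q Vq)[bq sq sq']]]] := spec_sharp_local s q.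
have [W Wq [c [d /(_ q Wq)[dq tq tq']]]] := spec_sharp_local t q.
have b0 := spec_den_neq0 (bq : b \notin spec_comap phi (val q)).
have d0 := spec_den_neq0 (dq : d \notin spec_comap phi (val q)).
have pb0 := spec_den_neq0 bq; have pd0 := spec_den_neq0 dq.
suff: local_map (val q) (s (comap_pt q) - t (comap_pt q)) =
  spec_sharp_fun s q - spec_sharp_fun t q by [].
rewrite sq' tq' sq tq.
rewrite -!mulNr !addf_div // -!tofracN -!tofracM -!tofracD local_mapE.
  by rewrite rmorphD !rmorphM rmorphN.
by rewrite rmorphM; exact: spec_primeM.
Qed.

Lemma spec_sharp_monoid U : monoid_morphism (@spec_sharp U).
Proof.
split=> [|s t]; apply: val_inj; apply/funext => q.
  suff: local_map (val q) 1 = 1 by [].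
  have q1 : phi 1 \notin val q.
    by rewrite rmorph1; have [] := spec_ideal (val q).
  by rewrite -[1 in LHS](divr1 1) -tofrac1 local_mapE // rmorph1 tofrac1 divr1.
have [V Vq [a [b /(_ q Vq)[bq sq sq']]]] := spec_sharp_local s q.
have [W Wq [c [d /(_ q Wq)[dq tq tq']]]] := spec_sharp_local t q.
suff: local_map (val q) (s (comap_pt q) * t (comap_pt q)) =
  spec_sharp_fun s q * spec_sharp_fun t q by [].
rewrite sq' tq' sq tq.
rewrite !mulf_div -!tofracM local_mapE ?rmorphM //.
exact: spec_primeM.
Qed.

HB.instance Definition _ (U : opens (spec R)) :=
  GRing.isZmodMorphism.Build (spec_sec U) (spec_sec (opre comap_cont U))
    (@spec_sharp U) (@spec_sharp_zmod U).
HB.instance Definition _ (U : opens (spec R)) :=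
  GRing.isMonoidMorphism.Build (spec_sec U) (spec_sec (opre comap_cont U))
    (@spec_sharp U) (@spec_sharp_monoid U).

Lemma spec_sharp_nat U V (h : osub V U) (s : spec_sec U) :
  spec_sharp (spec_res h s) = spec_res (opre_sub h) (spec_sharp s).
Proof.
apply: val_inj; apply/funext => q; rewrite /= /spec_sharp_fun /=.
by congr (local_map _ (s _)); exact: val_inj.
Qed.

Definition Spec_map : rsMorphism (Spec_rs S) (Spec_rs R) :=
  @RSMorphism (Spec_rs S) (Spec_rs R) (spec_comap phi) comap_cont
    (fun U => @spec_sharp U) spec_sharp_nat.

End SpecMorphism.

Lemma zero_ideal (R : idomainType) : idealr_closed [pred a : R | a == 0].
Proof.
split; rewrite ?inE ?oner_eq0 // => a u v; rewrite !inE.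
by move=> /eqP-> /eqP->; rewrite mulr0 addr0.
Qed.

Lemma zero_ideal_prime (R : idomainType) :
  prime_idealr_closed [pred a : R | a == 0].
Proof. by move=> a b; rewrite !inE mulf_eq0. Qed.

Definition spec_generic (R : idomainType) : spec R :=
  Spec (zero_ideal R) (@zero_ideal_prime R).

(* R^o is R as a module over itself, so its submodules are the ideals of R. *)
Definition noetherian (R : comNzRingType) :=
  forall I : {pred R^o}, submod_closed I -> exists gens : seq R,
    forall x : R, x \in I <->
      exists c : 'I_(size gens) -> R, x = \sum_i c i * gens`_i.

Definition finite_morphism (R S : comNzRingType) (phi : {rmorphism R -> S}) :=
  exists gens : seq S, forall x : S,
    exists c : 'I_(size gens) -> R, x = \sum_i phi (c i) * gens`_i.

(* Spec phi maps generic point to generic point and induces an isomorphism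
   of the local rings there, which are the function fields. *)
Definition birational (R S : idomainType) (phi : {rmorphism R -> S}) :=
  spec_comap phi (spec_generic S) = spec_generic R /\
  bijective (local_map phi (spec_generic S)).

(* Main.v *)
Require Import Defs.
From HB Require Import structures.
From mathcomp Require Import all_boot all_order all_algebra.
From mathcomp Require Import all_classical.
From mathcomp Require Import topology.
From mathcomp Require Import zify.

(** The ring [S] lies between [R] and its fraction field [K], because [phi] is
    birational; the point is to show that [S] is no larger than [R], and the
    proof does so by exhibiting each [x] in [S] as a trace.

    Write [J] for the push-forward of the resolution [I].  Near a prime [p],
    perfectness links [J] to a bounded complex [F] of direct summands of finite
    free modules by a roof of quasi-isomorphisms.  A chain map out of such an
    [F] lifts, on a neighbourhood of [p] and up to homotopy, through every
    quasi-isomorphism ([lift_along]): one works down from the top degree, where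
    [F] vanishes, and in each degree only the finitely many generators have to
    be lifted, so finitely many shrinkings suffice.  Lifting twice along the
    roof transports multiplication by [x] on [J] to a chain endomorphism [psi]
    of [F] near [p] ([homotopy_action]).

    The supertrace of [psi] is a section of the structure sheaf near [p].  At
    the generic point the cohomology of [F] is that of [J], namely [K] in
    degree 0 ([derived_unit_quasi_iso_at] at the generic point: Spec S and
    Spec R are isomorphic there), and [psi] acts on it as [x].  Over a field,
    a chain endomorphism that kills cohomology has supertrace 0
    ([alt_trace_null]); hence the supertrace of [psi] is [x]
    ([trace_section]).  So [x] belongs to every localization of [R] at a prime,
    and therefore to [R], since the denominators of [x] form an ideal lying in
    no prime ([perfect_local_frac], [birational_perfect_surjective]).

    Thus [phi] is bijective, Spec S is isomorphic to Spec R everywhere, and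
    the local comparison [derived_unit_quasi_iso_at] applies at all points. *)

Set Implicit Arguments.
Unset Strict Implicit.
Unset Printing Implicit Defensive.

Import Order.TTheory GRing.Theory Num.Theory.

Local Open Scope classical_set_scope.
Local Open Scope ring_scope.

(** * Supertraces of complexes of vector spaces *)

Section AlternatingTrace.
Variables (K : fieldType) (n : int -> nat).
Variable D : forall i, 'M[K]_(n i, n (i + 1)).
Variable Theta : forall i, 'M[K]_(n i).
Hypothesis DD : forall i, D i *m D (i + 1) = 0.
Hypothesis ThetaD : forall i, Theta i *m D i = D i *m Theta (i + 1).
Hypothesis Theta0 : forall i (v : 'rV_(n (i + 1))),
  v *m D (i + 1) = 0 -> (v *m Theta (i + 1) <= D i)%MS.

Let tau i := \tr (D i *m pinvmx (D i) *m Theta i).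

(** Choosing [Q] with [D Q D = D] splits the identity into [D Q] and [1 - D Q].
    The image of the second factor consists of cocycles, which [Theta] sends to
    coboundaries; by cyclicity of the trace its contribution is then the
    contribution of the first factor one degree lower. *)
Lemma trace_null_cohomology i : \tr (Theta (i + 1)) = tau (i + 1) + tau i.
Proof.
have DQD j : D j *m pinvmx (D j) *m D j = D j by exact: mulmxKpV.
set Q := pinvmx (D (i + 1)); set E := 1%:M - D (i + 1) *m Q.
have ED : E *m D (i + 1) = 0 by rewrite mulmxBl mul1mx DQD subrr.
have EB : (E *m Theta (i + 1) <= D i)%MS.
  apply/row_subP => j; rewrite row_mul; apply: Theta0.
  by rewrite -row_mul ED row0.
have -> : Theta (i + 1) = D (i + 1) *m Q *m Theta (i + 1)
    + E *m Theta (i + 1) *m pinvmx (D i) *m D i.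
  by rewrite (mulmxKpV EB) -mulmxDl [_ + E]addrC subrK mul1mx.
rewrite mxtraceD; congr (_ + _).
rewrite /tau mxtrace_mulC; move: (pinvmx (D i)) => P.
rewrite !mulmxA mulmxBr mulmx1 mulmxA DD mul0mx subr0 -ThetaD.
by rewrite -(mulmxA (Theta i)) mxtrace_mulC.
Qed.

(** The alternating sum telescopes, and its two ends vanish with [D]. *)
Lemma alt_trace_null (i : int) (m : nat) : D i = 0 -> D (i + m%:Z) = 0 ->
  \sum_(k < m) (-1) ^+ k * \tr (Theta (i + k%:Z + 1)) = 0.
Proof.
move=> Di Dm; have tau0 j : D j = 0 -> tau j = 0.
  by move=> Dj; rewrite /tau Dj !mul0mx mxtrace0.
suff E k : \sum_(j < k) (-1) ^+ j * \tr (Theta (i + j%:Z + 1)) =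
    tau i - (-1) ^+ k * tau (i + k%:Z).
  by rewrite E !tau0 // mulr0 subrr.
elim: k => [|k IHk]; first by rewrite big_ord0 expr0 mul1r addr0 subrr.
rewrite big_ord_recr /= IHk trace_null_cohomology.
have -> : i + k.+1%:Z = i + k%:Z + 1 by rewrite -addn1 PoszD addrA.
by rewrite exprS mulN1r mulNr opprK mulrDr [X in _ + X]addrC addrA subrK.
Qed.

End AlternatingTrace.

(** * Restriction of sections, and quasi-isomorphisms at a point *)

Section Restriction.
Variables (X : ringedSpace) (M : omod X).
Implicit Types (U V W : opens X).

Lemma oresD U V (h : osub V U) (x y : M U) :
  ores h (x + y) = ores h x + ores h y.
Proof. by have := ores_linear h 1 x y; rewrite rmorph1 !scale1r. Qed.

Lemma oresZ U V (h : osub V U) a (x : M U) :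
  ores h (a *: x) = rs_res h a *: ores h x.
Proof. by have := ores_linear h a x 0; rewrite ores0 !addr0. Qed.

Lemma oresN U V (h : osub V U) (x : M U) : ores h (- x) = - ores h x.
Proof. by rewrite -scaleN1r oresZ rmorphN1 scaleN1r. Qed.

Lemma oresB U V (h : osub V U) (x y : M U) :
  ores h (x - y) = ores h x - ores h y.
Proof. by rewrite oresD oresN. Qed.

Lemma ores_comp U V W (h : osub V U) (k : osub W V) (l : osub W U) (x : M U) :
  ores k (ores h x) = ores l x.
Proof. exact: (sheaf_comp (@omod_sheaf X M)). Qed.

Lemma ores_id U (h : osub U U) (x : M U) : ores h x = x.
Proof. exact: (sheaf_id (@omod_sheaf X M)). Qed.

Lemma ores_sum U V (h : osub V U) (J : finType) (x : J -> M U) :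
  ores h (\sum_j x j) = \sum_j ores h (x j).
Proof. by apply: (big_morph _ (oresD h)); exact: ores0. Qed.

End Restriction.

Section OHom.
Variables (X : ringedSpace) (M N : omod X) (f : ohom M N) (U : opens X).

Lemma ohom0 : f U 0 = 0. Proof. exact: linear0. Qed.

Lemma ohomD x y : f U (x + y) = f U x + f U y. Proof. exact: linearD. Qed.

Lemma ohomB x y : f U (x - y) = f U x - f U y. Proof. exact: linearB. Qed.

Lemma ohomZ a x : f U (a *: x) = a *: f U x. Proof. exact: linearZZ. Qed.

Lemma ohom_sum (J : finType) (x : J -> M U) :
  f U (\sum_j x j) = \sum_j f U (x j).
Proof. exact: linear_sum. Qed.

End OHom.

Lemma rs_res_comp (X : ringedSpace) (U V W : opens X) (h : osub V U)
  (k : osub W V) (l : osub W U) (a : \O_X U) :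
  rs_res k (rs_res h a) = rs_res l a.
Proof. exact: (sheaf_comp (@rs_sheaf X)). Qed.

Definition osubT (T : topologicalType) (U : opens T) : osub U (Opens openT) :=
  fun _ _ => I.

Definition osub_trans (T : topologicalType) (U V W : opens T)
  (h : osub V U) (k : osub W V) : osub W U := fun p Wp => h p (k p Wp).

Definition osubIl (T : topologicalType) (U V : opens T) : osub (opensI U V) U :=
  fun p => @proj1 _ _.
Definition osubIr (T : topologicalType) (U V : opens T) : osub (opensI U V) V :=
  fun p => @proj2 _ _.

Arguments osubT {T} U.
Arguments osubIl {T} U V.
Arguments osubIr {T} U V.

(** The stalkwise form of [quasi_iso]: the unit has to be compared at the
    generic point alone before it is known to be a quasi-isomorphism
    elsewhere. *)
Section QuasiIsoAt.
Variables (X : ringedSpace) (M N : complex X) (f : chainMap M N) (p : X).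

Definition coh_injective_at (i : int) :=
  forall U (x : M (i + 1) U) (y : N i U), oset U p ->
    cdiff M (i + 1) U x = 0 -> f (i + 1) U x = cdiff N i U y ->
    exists (W : opens X) (h : osub W U) (z : M i W),
      oset W p /\ ores h x = cdiff M i W z.

Definition coh_surjective_at (i : int) :=
  forall U (y : N (i + 1) U), oset U p -> cdiff N (i + 1) U y = 0 ->
    exists (W : opens X) (h : osub W U) (x : M (i + 1) W) (z : N i W),
      [/\ oset W p, cdiff M (i + 1) W x = 0 &
          ores h y = f (i + 1) W x + cdiff N i W z].

Definition quasi_iso_at := forall i, coh_injective_at i /\ coh_surjective_at i.

End QuasiIsoAt.

Lemma quasi_isoP (X : ringedSpace) (M N : complex X) (f : chainMap M N) :
  quasi_iso f <-> forall p, quasi_iso_at f p.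
Proof.
split=> [qf p i|qf i].
  have [fi fs] := qf i; split=> [U x y Up dx fx|U y Up dy].
    exact: (fi U x y dx fx p Up).
  exact: (fs U y dy p Up).
split=> [U x y dx fx p Up|U y dy p Up].
  by have [fi _] := qf p i; exact: (fi U x y Up dx fx).
by have [_ fs] := qf p i; exact: (fs U y Up dy).
Qed.

(** * Homomorphisms over an open set *)

(** A homomorphism of the restrictions of [M] and [N] to [W], given by its
    components over the open subsets of [W].  Unlike [ohom] over the restricted
    ringed space it needs no change of base when [W] shrinks. *)
Record lhom (X : ringedSpace) (W : opens X) (M N : omod X) := LHom {
  lfun :> forall V, osub V W -> M V -> N V;
  lfun_linear : forall V (h : osub V W) a x y,
    lfun h (a *: x + y) = a *: lfun h x + lfun h y;
  lfun_nat : forall U V (h : osub U W) (h' : osub V W) (k : osub V U) x,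
    lfun h' (ores k x) = ores k (lfun h x) }.

Section LHom.
Variables (X : ringedSpace).
Implicit Types (U V W : opens X) (M N P : omod X).

Lemma lfunD W M N (f : lhom W M N) V (h : osub V W) x y :
  f V h (x + y) = f V h x + f V h y.
Proof. by have := lfun_linear f h 1 x y; rewrite !scale1r. Qed.

Lemma lfun0 W M N (f : lhom W M N) V (h : osub V W) : f V h 0 = 0.
Proof. by apply: (@addrI _ (f V h 0)); rewrite -lfunD !addr0. Qed.

Lemma lfunZ W M N (f : lhom W M N) V (h : osub V W) a x :
  f V h (a *: x) = a *: f V h x.
Proof. by have := lfun_linear f h a x 0; rewrite lfun0 !addr0. Qed.

Lemma lfun_sum W M N (f : lhom W M N) V (h : osub V W) (J : finType)
  (x : J -> M V) : f V h (\sum_j x j) = \sum_j f V h (x j).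
Proof. by apply: (big_morph _ (lfunD f h)); exact: lfun0. Qed.

Lemma lzero_linear M N V a (x y : M V) : (0 : N V) = a *: 0 + 0.
Proof. by rewrite scaler0 addr0. Qed.

Definition lzero W M N : lhom W M N :=
  @LHom X W M N (fun V h x => 0) (fun V h a x y => lzero_linear N a x y)
    (fun U V h h' k x => esym (ores0 N k)).

Definition lid W M : lhom W M M :=
  @LHom X W M M (fun V h x => x) (fun V h a x y => erefl)
    (fun U V h h' k x => erefl).

Definition lrestr W W' (h : osub W' W) M N (f : lhom W M N) : lhom W' M N :=
  @LHom X W' M N (fun V k x => f V (osub_trans h k) x)
    (fun V k a x y => lfun_linear f _ a x y)
    (fun U V k k' l x => lfun_nat f _ _ l x).

Lemma lpost_linear W M N P (g : ohom N P) (f : lhom W M N) V (h : osub V W)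
  a x y : g V (f V h (a *: x + y)) = a *: g V (f V h x) + g V (f V h y).
Proof. by rewrite lfun_linear ohomD ohomZ. Qed.

Lemma lpost_nat W M N P (g : ohom N P) (f : lhom W M N) U V (h : osub U W)
  (h' : osub V W) (k : osub V U) x :
  g V (f V h' (ores k x)) = ores k (g U (f U h x)).
Proof. by rewrite (lfun_nat f h) ohom_nat. Qed.

Definition lpost W M N P (g : ohom N P) (f : lhom W M N) : lhom W M P :=
  @LHom X W M P (fun V h x => g V (f V h x)) (lpost_linear g f) (lpost_nat g f).

End LHom.

(** A direct summand [F] of a free module is generated by the images [gen j] of
    the basis vectors.  They need not be independent, but the inclusion singles
    out coordinates of each section, linear in the section and compatible with
    restriction. *)
Section Generators.
Variables (X : ringedSpace) (F : omod X) (n : nat).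
Variables (inc : ohom F (free_mod X n)) (prj : ohom (free_mod X n) F).
Hypothesis incK : forall U x, prj U (inc U x) = x.

Definition coords U (x : F U) : 'rV[\O_X U]_n := inc U x.

Definition gen (j : 'I_n) : F (Opens openT) := prj _ (delta_mx 0 j : 'rV_n).

Lemma coords_linear U a (x y : F U) :
  coords (a *: x + y) = a *: coords x + coords y.
Proof. exact: (linearP (inc U)). Qed.

Lemma coords_res U V (h : osub V U) (x : F U) :
  coords (ores h x) = map_mx (rs_res h) (coords x).
Proof. exact: (ohom_nat inc h x). Qed.

Lemma prj_sum U (c : 'rV[\O_X U]_n) :
  prj U c = \sum_j c 0 j *: ores (osubT U) (gen j).
Proof.
rewrite {1}(row_sum_delta c).
have -> : prj U (\sum_j c 0 j *: delta_mx 0 j : 'rV_n)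
        = \sum_j prj U (c 0 j *: delta_mx 0 j : 'rV_n).
  exact: (raddf_sum (prj U)).
apply: eq_bigr => j _.
rewrite [LHS](linearZZ (prj U)); congr (_ *: _).
rewrite /gen -ohom_nat; congr (prj U _).
by apply/rowP => k; rewrite !mxE rmorph_nat.
Qed.

Lemma gen_sum U (x : F U) :
  x = \sum_j coords x 0 j *: ores (osubT U) (gen j).
Proof. by rewrite -prj_sum incK. Qed.

Section FromGenerators.
Variables (N : omod X) (W : opens X) (m : 'I_n -> N W).

Let lspan_fun V (h : osub V W) (x : F V) := \sum_j coords x 0 j *: ores h (m j).

Fact lspan_linear V (h : osub V W) a x y :
  lspan_fun h (a *: x + y) = a *: lspan_fun h x + lspan_fun h y.
Proof.
rewrite /lspan_fun scaler_sumr -big_split /=; apply: eq_bigr => j _.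
by rewrite coords_linear !mxE scalerDl scalerA.
Qed.

Fact lspan_nat U V (h : osub U W) (h' : osub V W) (k : osub V U) x :
  lspan_fun h' (ores k x) = ores k (lspan_fun h x).
Proof.
rewrite /lspan_fun ores_sum; apply: eq_bigr => j _.
by rewrite oresZ coords_res mxE (ores_comp _ _ h').
Qed.

(** Any family [m] defines a homomorphism out of [F], since one out of the free
    module can be restricted to the summand; it need not send [gen j] to
    [m j]. *)
Definition lspan : lhom W F N := LHom lspan_linear lspan_nat.

Lemma lspanE V (h : osub V W) (x : F V) :
  lspan V h x = \sum_j coords x 0 j *: ores h (m j).
Proof. by []. Qed.

End FromGenerators.

Lemma lhomE (N : omod X) (W : opens X) (f : lhom W F N) V (h : osub V W)
    (k : osub W W) (x : F V) :
  f V h x = \sum_j coords x 0 j *: ores h (f W k (ores (osubT W) (gen j))).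
Proof.
rewrite {1}(gen_sum x) lfun_sum; apply: eq_bigr => j _.
by rewrite lfunZ -(lfun_nat f k h) (ores_comp _ _ (osubT V)).
Qed.

End Generators.

(** * Lifting through a quasi-isomorphism *)

Lemma shrink_finite (T : topologicalType) (p : T) (W0 : opens T) (J : finType)
    (P : J -> forall W, osub W W0 -> Prop) : oset W0 p ->
  (forall j, exists W h, oset W p /\ P j W h) ->
  (forall j W W' h (k : osub W' W), P j W h -> P j W' (osub_trans h k)) ->
  exists W h, oset W p /\ forall j, P j W h.
Proof.
move=> W0p exP resP.
suff [W [h [Wp PW]]] : exists W h, oset W p /\ {in enum J, forall j, P j W h}.
  by exists W, h; split=> // j; apply: PW; rewrite mem_enum.
elim: (enum J) => [|j s [W [h [Wp PW]]]].
  by exists W0, (fun _ => id).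
have [V [k [Vp PV]]] := exP j.
exists (opensI W V), (osub_trans h (osubIl W V)); split=> // i.
rewrite inE => /predU1P[->|si]; last exact: resP (PW i si).
have -> : osub_trans h (osubIl W V) = osub_trans k (osubIr W V).
  exact: Prop_irrelevance.
exact: resP.
Qed.

Section Lift.
Variables (X : ringedSpace) (p : X) (F : complex X).
Variables (n : int -> nat).
Variables (inc : forall i, ohom (F i) (free_mod X (n i))).
Variables (prj : forall i, ohom (free_mod X (n i)) (F i)).
Hypothesis incK : forall i U x, prj i U (inc i U x) = x.
Variables (a b : int).
Hypothesis F_bounded : forall i, (i < a) || (b < i) -> is_zero (F i).

Definition local_chain W (B : complex X) (f : forall i, lhom W (F i) (B i)) :=
  forall i V (h : osub V W) x,
    f (i + 1) V h (cdiff F i V x) = cdiff B i V (f i V h x).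

Variables (A B : complex X) (q : chainMap A B).
Hypothesis q_iso : quasi_iso_at q p.

(** In degree [i + 1], [g] is a lift of [f] through [q] up to the homotopy
    [k]. *)
Definition lift_eq W (f : forall i, lhom W (F i) (B i))
    (g : forall i, lhom W (F i) (A i))
    (k : forall i, lhom W (F (i + 1)) (B i)) (i : int) :=
  (forall V h x, g (i + 1 + 1) V h (cdiff F (i + 1) V x) =
     cdiff A (i + 1) V (g (i + 1) V h x)) /\
  (forall V h x, q (i + 1) V (g (i + 1) V h x) = f (i + 1) V h x +
     (cdiff B i V (k i V h x) + k (i + 1) V h (cdiff F (i + 1) V x))).

(** Descent by one degree.  For a generator [x], the cocycle [g (d x)] becomes a
    coboundary in [B], so it is [d v] already in [A]; the error
    [q v - f x - k (d x)] is a cocycle of [B], hence comes from a cocycle of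
    [A], which is subtracted from [v], up to a coboundary [d w]; and [w] is the
    next value of the homotopy. *)
Lemma lift_step W f g k (i : int) : local_chain f -> oset W p ->
  lift_eq f g k (i + 1) -> exists W' (h : osub W' W)
    (g' : lhom W' (F (i + 1)) (A (i + 1))) (k' : lhom W' (F (i + 1)) (B i)),
    [/\ oset W' p,
    forall V l x, g (i + 1 + 1) V (osub_trans h l) (cdiff F (i + 1) V x) =
     cdiff A (i + 1) V (g' V l x) &
    forall V l x, q (i + 1) V (g' V l x) = f (i + 1) V (osub_trans h l) x +
     (cdiff B i V (k' V l x) +
      k (i + 1) V (osub_trans h l) (cdiff F (i + 1) V x))].
Proof.
move=> fC Wp [gC gk].
have Wid : osub W W by [].
pose e j := ores (osubT W) (gen (prj (i + 1)) j).
have eE U (l : osub U W) j :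
    ores (osubT U) (gen (prj (i + 1)) j) = ores l (e j).
  by rewrite (ores_comp _ _ (osubT U)).
clearbody e.
pose P j V (h : osub V W) := exists (v : A (i + 1) V) (w : B i V),
  cdiff A (i + 1) V v = g (i + 1 + 1) V h (cdiff F (i + 1) V (ores h (e j))) /\
  q (i + 1) V v = f (i + 1) V h (ores h (e j)) + (cdiff B i V w +
    k (i + 1) V h (cdiff F (i + 1) V (ores h (e j)))).
have [|j U V h l [v [w [dv qv]]]|V [h [Vp PV]]] := @shrink_finite _ p W _ P Wp.
- move=> j; set x := e j.
  pose u := g (i + 1 + 1) W Wid (cdiff F (i + 1) W x).
  pose y := f (i + 1) W Wid x + k (i + 1) W Wid (cdiff F (i + 1) W x).
  have du : cdiff A _ W u = 0 by rewrite -gC cdiffK lfun0.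
  have qu : q _ W u = cdiff B _ W y.
    by rewrite gk fC cdiffK lfun0 addr0 -ohomD.
  have [V [h [v [Vp uv]]]] := (q_iso (i + 1)).1 W u y Wp du qu.
  have dy : cdiff B (i + 1) V (q (i + 1) V v - ores h y) = 0.
    by rewrite ohomB -chain_nat -uv !ohom_nat qu subrr.
  have [V' [h' [z [w [V'p dz E]]]]] := (q_iso i).2 V _ Vp dy.
  exists V', (osub_trans h h'); split=> //.
  exists (ores h' v - z), w; split.
    rewrite ohomB dz subr0 ohom_nat -uv (ores_comp _ _ (osub_trans h h')).
    by rewrite /u -(lfun_nat _ _ (osub_trans h h')) ohom_nat.
  rewrite ohomB ohom_nat.
  move: E; rewrite oresB => /eqP; rewrite subr_eq => /eqP ->.
  rewrite (ores_comp _ _ (osub_trans h h')).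
  rewrite addrAC -[_ + _ - _]addrA addrC addrA.
  rewrite [q _ _ z + _]addrC addrK addrC /y oresD.
  rewrite -!(lfun_nat _ _ (osub_trans h h')) -ohom_nat.
  exact: addrCA.
- exists (ores l v), (ores l w).
  rewrite !ohom_nat dv qv !oresD -!ohom_nat.
  have E : ores l (ores h (e j)) = ores (osub_trans h l) (e j).
    exact: ores_comp.
  by rewrite -!(lfun_nat _ _ (osub_trans h l)) -!ohom_nat E.
have [v vP] := choice PV; have [w wP] := choice vP.
exists V, h, (lspan (inc (i + 1)) v), (lspan (inc (i + 1)) w).
have {}eE U (l : osub U V) j :
    ores (osubT U) (gen (prj (i + 1)) j) = ores l (ores h (e j)).
  by rewrite (ores_comp _ _ (osub_trans h l)); exact: eE.
split=> // U l x; rewrite !lspanE.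
  rewrite {1}(gen_sum (@incK _) x) !ohom_sum lfun_sum.
  apply: eq_bigr => j _; rewrite !ohomZ lfunZ; congr (_ *: _).
  rewrite (eE _ l) !ohom_nat (wP j).1 -(lfun_nat _ _ (osub_trans h l)).
  by rewrite -ohom_nat.
rewrite {2 4}(gen_sum (@incK _) x) !ohom_sum !lfun_sum -!big_split /=.
apply: eq_bigr => j _; rewrite !ohomZ !lfunZ -!scalerDr; congr (_ *: _).
rewrite (eE _ l) !ohom_nat (wP j).2 !oresD -!(lfun_nat _ _ (osub_trans h l)).
by rewrite -!ohom_nat.
Qed.

Lemma is_zero_eq0 i U (x : F (i + 1) U) : (i + 1 < a) || (b < i + 1) -> x = 0.
Proof. by move=> ib; exact: F_bounded. Qed.

Lemma lift_eq_trivial W f (g : forall i, lhom W (F i) (A i)) k i :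
  (i + 1 < a) || (b < i + 1) -> @lift_eq W f g k i.
Proof.
move=> ib; split=> V h x; rewrite (is_zero_eq0 x ib) ?(ohom0, lfun0) //.
by rewrite !addr0.
Qed.

(** A bounded complex of summands of finite free modules is, locally, projective
    with respect to quasi-isomorphisms. *)
Lemma lift_along W0 (f : forall i, lhom W0 (F i) (B i)) :
  local_chain f -> oset W0 p -> exists W (h : osub W W0) g k,
    oset W p /\ forall i, lift_eq (fun i => lrestr h (f i)) g k i.
Proof.
move=> fC W0p.
have [c cP] : exists c : nat, b - c%:Z < a.
  exists `|b - a|%N.+1; lia.
suff /(_ c)[W [h [g [k [Wp E]]]]] : forall m : nat,
    exists W (h : osub W W0) g k, oset W p /\
    forall i, b - m%:Z <= i -> lift_eq (fun i => lrestr h (f i)) g k i.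
  exists W, h, g, k; split=> // i; have [/E//|bi] := leP (b - c%:Z) i.
  apply: lift_eq_trivial.
  by apply/orP; left; lia.
(* The lift is built for degrees above [b - m], by induction on [m]. *)
elim=> [|m [W [h [g [k [Wp E]]]]]].
  exists W0, (fun _ => id), (fun i => lzero _ _ _), (fun i => lzero _ _ _).
  split=> // i; rewrite subr0 => bi; apply: lift_eq_trivial.
  by apply/orP; right; lia.
pose j := b - m.+1%:Z.
have jE : j + 1 = b - m%:Z by rewrite /j; lia.
have fC' : local_chain (fun i => lrestr h (f i)) by move=> *; exact: fC.
have := E (j + 1); rewrite jE lexx -{1}jE => /(_ isT) Ej.
have [W' [h' [g' [k' [W'p gC gk]]]]] := lift_step fC' Wp Ej.
exists W', (osub_trans h h').
exists (dfwith (fun i => lrestr h' (g i)) (j + 1) g').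
exists (dfwith (fun i => lrestr h' (k i)) j k').
split=> // i; rewrite le_eqVlt => /predU1P[<-|ji].
  rewrite -/j; split=> V l x.
    rewrite dfwithin dfwithout; last by lia.
    exact: gC.
  rewrite !dfwithin dfwithout; last by lia.
  exact: gk.
have mi : b - m%:Z <= i by lia.
have [EC Ek] := E i mi; split=> V l x.
  by rewrite !dfwithout; [exact: EC|lia|lia].
by rewrite !dfwithout; [exact: Ek|lia|lia|lia].
Qed.

End Lift.

(** * Germs at a point whose local ring is a field *)

(** The maps [kap] present the field [K] as the stalk of the structure sheaf at
    [eta]: every element comes from a section near [eta], and a section with
    zero image vanishes near [eta]. *)
Section GenericStalk.
Variables (X : ringedSpace) (eta : X) (K : fieldType).
Variable kap : forall U : opens X, oset U eta -> {rmorphism \O_X U -> K}.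
Hypothesis kap_res : forall U V (h : osub V U) (Ue : oset U eta)
  (Ve : oset V eta) a, kap Ve (rs_res h a) = kap Ue a.
Hypothesis kap_lift : forall (c : K) U, oset U eta ->
  exists V (_ : osub V U) (Ve : oset V eta) a, kap Ve a = c.
Hypothesis kap_inj : forall U (Ue : oset U eta) a, kap Ue a = 0 ->
  exists V (h : osub V U), oset V eta /\ rs_res h a = 0.

Section Germs.
Variables (F : omod X) (n : nat) (inc : ohom F (free_mod X n)).
Variable (prj : ohom (free_mod X n) F).
Hypothesis incK : forall U x, prj U (inc U x) = x.

Definition germ U (Ue : oset U eta) (x : F U) : 'rV[K]_n :=
  map_mx (kap Ue) (coords inc x).

Lemma germ_linear U (Ue : oset U eta) a (x y : F U) :
  germ Ue (a *: x + y) = kap Ue a *: germ Ue x + germ Ue y.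
Proof. by rewrite /germ coords_linear map_mxD map_mxZ. Qed.

Lemma germD U (Ue : oset U eta) (x y : F U) :
  germ Ue (x + y) = germ Ue x + germ Ue y.
Proof. by have := germ_linear Ue 1 x y; rewrite rmorph1 !scale1r. Qed.

Lemma germ0 U (Ue : oset U eta) : germ Ue (0 : F U) = 0.
Proof. by apply: (@addrI _ (germ Ue 0)); rewrite -germD !addr0. Qed.

Lemma germZ U (Ue : oset U eta) a (x : F U) :
  germ Ue (a *: x) = kap Ue a *: germ Ue x.
Proof. by have := germ_linear Ue a x 0; rewrite germ0 !addr0. Qed.

Lemma germB U (Ue : oset U eta) (x y : F U) :
  germ Ue (x - y) = germ Ue x - germ Ue y.
Proof. by rewrite -scaleN1r addrC germ_linear rmorphN1 scaleN1r addrC. Qed.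

Lemma germ_sum U (Ue : oset U eta) (J : finType) (x : J -> F U) :
  germ Ue (\sum_j x j) = \sum_j germ Ue (x j).
Proof. by apply: (big_morph _ (germD Ue)); exact: germ0. Qed.

Lemma germ_res U V (h : osub V U) (Ue : oset U eta) (Ve : oset V eta) x :
  germ Ve (ores h x) = germ Ue x.
Proof.
by rewrite /germ coords_res; apply/rowP => j; rewrite !mxE kap_res.
Qed.

Lemma germ_eq0 U (Ue : oset U eta) (x : F U) : germ Ue x = 0 ->
  exists V (h : osub V U), oset V eta /\ ores h x = 0.
Proof.
move=> gx.
have [|j V V' h k /= E|V [h [Ve VP]]] := @shrink_finite _ eta U 'I_n
  (fun j V h => rs_res h (coords inc x 0 j) = 0) Ue.
- move=> j; have [|V [h [Ve E]]] := @kap_inj U Ue (coords inc x 0 j).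
    by have /rowP/(_ j) := gx; rewrite !mxE.
  by exists V, h.
- by rewrite -(rs_res_comp h k) E rmorph0.
exists V, h; split=> //; rewrite (gen_sum incK (ores h x)) big1 // => j _.
by rewrite coords_res mxE VP scale0r.
Qed.

(** The idempotent of [K^n] whose row space is the stalk of [F]. *)
Definition germ_id : 'M[K]_n :=
  \matrix_j germ (I : oset (Opens openT) eta) (gen prj j).

Lemma germ_lift (v : 'rV[K]_n) U : oset U eta ->
  exists V (_ : osub V U) (Ve : oset V eta) (x : F V),
    germ Ve x = v *m germ_id.
Proof.
move=> Ue.
have [|j V V' h k /= [a aE]|V [h [Ve VP]]] := @shrink_finite _ eta U 'I_n
  (fun j V h => exists a, forall Ve, kap (U := V) Ve a = v 0 j) Ue.
- move=> j; have [V [h [Ve [a aE]]]] := kap_lift (v 0 j) Ue.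
  exists V, h; split=> //; exists a => Ve'.
  by rewrite (Prop_irrelevance Ve' Ve).
- by exists (rs_res k a) => Ve; rewrite (kap_res k (k _ Ve)).
have [a aE] := choice VP.
exists V, h, Ve, (\sum_j a j *: ores (osubT V) (gen prj j)).
rewrite germ_sum mulmx_sum_row; apply: eq_bigr => j _.
by rewrite germZ (germ_res _ (I : oset (Opens openT) eta)) rowK aE.
Qed.

End Germs.

Section LocalMatrix.
Variables (F F' : omod X) (n n' : nat).
Variables (inc : ohom F (free_mod X n)) (prj : ohom (free_mod X n) F).
Hypothesis incK : forall U x, prj U (inc U x) = x.
Variable (inc' : ohom F' (free_mod X n')).
Variables (W : opens X) (We : oset W eta) (f : lhom W F F').

Definition lmx : 'M[K]_(n, n') :=
  \matrix_j germ inc' We (f W (fun _ => id) (ores (osubT W) (gen prj j))).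

Lemma germ_lhom V (h : osub V W) (Ve : oset V eta) x :
  germ inc' Ve (f V h x) = germ inc Ve x *m lmx.
Proof.
rewrite (lhomE incK f h (fun _ => id)) germ_sum mulmx_sum_row.
apply: eq_bigr => j _; rewrite germZ (germ_res _ _ We) rowK.
by rewrite /germ mxE.
Qed.

End LocalMatrix.

(** * The supertrace of an endomorphism of a perfect complex *)

(** The complex [J] is linked to [F] by the roof of [s] and [t].  At [eta] its
    cohomology is spanned by the classes [j], that is, by one nonzero class in
    degree 0, and its endomorphism [mu] is multiplication by [c0] there; every
    neighbourhood of [p] contains [eta]. *)
Section Supertrace.
Variables (p : X) (p_eta : forall U : opens X, oset U p -> oset U eta).
Variables (J G F : complex X) (s : chainMap G J) (t : chainMap G F).
Hypotheses (sp : quasi_iso_at s p) (se : quasi_iso_at s eta).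
Hypotheses (tp : quasi_iso_at t p) (te : quasi_iso_at t eta).
Variables (n : int -> nat).
Variables (inc : forall i, ohom (F i) (free_mod X (n i))).
Variables (prj : forall i, ohom (free_mod X (n i)) (F i)).
Hypothesis incK : forall i U x, prj i U (inc i U x) = x.
Variables (a b : int).
Hypothesis F_bounded : forall i, (i < a) || (b < i) -> is_zero (F i).
Variables (mu : chainMap J J) (c0 : K) (U0 : opens X) (a0 : \O_X U0).
Hypotheses (U0e : oset U0 eta) (a0E : kap U0e a0 = c0).
Hypothesis muE : forall i V (h : osub V U0) (x : J i V),
  mu i V x = rs_res h a0 *: x.
Variable j : forall i, J i (Opens openT).
Hypothesis dj : forall i, cdiff J i _ (j i) = 0.
Hypothesis j0 : forall i, i != 0 -> j i = 0.
Hypothesis j_gen : forall i U (x : J (i + 1) U), oset U eta ->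
  cdiff J (i + 1) U x = 0 -> exists V (h : osub V U) c (w : J i V),
    oset V eta /\ ores h x = c *: ores (osubT V) (j (i + 1)) + cdiff J i V w.
Hypothesis j_neq0 : forall i, i + 1 = 0 -> forall U (w : J i U), oset U eta ->
  ores (osubT U) (j (i + 1)) <> cdiff J i U w.

Local Notation gm i Ue x := (germ (inc i) Ue x).

Definition dmx i : 'M[K]_(n i, n (i + 1)) :=
  lmx (prj i) (inc (i + 1)) (I : oset (Opens openT) eta)
    (lpost (cdiff F i) (lid _ (F i))).

Local Notation E i := (germ_id (inc i) (prj i)).

Lemma germ_d i U (Ue : oset U eta) (x : F i U) :
  gm (i + 1) Ue (cdiff F i U x) = gm i Ue x *m dmx i.
Proof.
exact: (germ_lhom (@incK i) (inc (i + 1)) (I : oset (Opens openT) eta)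
  (lpost (cdiff F i) (lid _ (F i))) (osubT U)).
Qed.

Lemma lmx_idl i m (M : omod X) (inc' : ohom M (free_mod X m)) W
    (We : oset W eta) (f : lhom W (F i) M) :
  E i *m lmx (prj i) inc' We f = lmx (prj i) inc' We f.
Proof.
apply/row_matrixP => k; rewrite row_mul !rowK.
have gE := germ_res (inc i) (osubT W) (I : oset (Opens openT) eta) We.
by rewrite -gE; exact/esym/(germ_lhom (@incK i)).
Qed.

Lemma dmx_idl i : E i *m dmx i = dmx i. Proof. exact: lmx_idl. Qed.

Lemma dmxK i : dmx i *m dmx (i + 1) = 0.
Proof.
by apply/row_matrixP => k; rewrite row_mul rowK row0 -germ_d cdiffK germ0.
Qed.

Lemma dmx_zero i : (i < a) || (b < i) -> dmx i = 0.
Proof.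
move=> ib; apply/row_matrixP => k; rewrite rowK row0.
by rewrite [X in lpost _ _ _ _ X](F_bounded ib) lfun0 germ0.
Qed.

Lemma cocycle_lift i (v : 'rV[K]_(n (i + 1))) U : oset U eta ->
  v *m dmx (i + 1) = 0 -> exists V (_ : osub V U) (Ve : oset V eta) x,
    gm (i + 1) Ve x = v *m E (i + 1) /\ cdiff F (i + 1) V x = 0.
Proof.
move=> Ue vD; have [V [h [Ve [x xE]]]] := germ_lift (inc _) (prj (i + 1)) v Ue.
have [|V' [h' [V'e dx]]] :=
  @germ_eq0 _ _ (inc _) _ (@incK _) V Ve (cdiff F (i + 1) V x).
  by rewrite germ_d xE -mulmxA dmx_idl.
exists V', (osub_trans h h'), V'e, (ores h' x).
by rewrite (germ_res _ _ Ve) ohom_nat.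
Qed.

Lemma germ_idr i U (Ue : oset U eta) (x : F i U) :
  gm i Ue x *m E i = gm i Ue x.
Proof.
rewrite {2}(gen_sum (@incK i) x) germ_sum mulmx_sum_row.
apply: eq_bigr => k _; rewrite germZ rowK mxE.
by rewrite -(germ_res _ (osubT U) (I : oset (Opens openT) eta) Ue).
Qed.

Lemma dmx_idr i : dmx i *m E (i + 1) = dmx i.
Proof. by apply/row_matrixP => k; rewrite row_mul rowK germ_idr. Qed.

(** The class [iota] of [j] in the cohomology of [F] at [eta] is found by
    lifting [j] through [s] and applying [t].  Both maps are bijective on
    cohomology at [eta], so [iota] spans there, and is a coboundary exactly
    when [j] is. *)
Lemma generator_class i : exists iota : 'rV[K]_(n (i + 1)),
  [/\ iota *m E (i + 1) = iota, iota *m dmx (i + 1) = 0,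
   (iota <= dmx i)%MS = (i + 1 != 0) &
   forall V (Ve : oset V eta) (x : F (i + 1) V), cdiff F (i + 1) V x = 0 ->
     exists c, (gm (i + 1) Ve x - c *: iota <= dmx i)%MS].
Proof.
have [W1 [h1 [z1 [w [W1e dz1 jE]]]]] := (se i).2 _ (j (i + 1)) I (dj _).
exists (gm (i + 1) W1e (t (i + 1) W1 z1)); split.
- exact: germ_idr.
- by rewrite -germ_d -chain_nat dz1 ohom0 germ0.
- apply/idP/idP => [/submxP[y yE]|i0].
    apply/negP => /eqP i0.
    have [V [h [Ve [y' y'E]]]] := germ_lift (inc _) (prj i) y W1e.
    have [|V' [h' [V'e]]] := @germ_eq0 _ _ (inc _) _ (@incK _) V Ve
        (ores h (t (i + 1) W1 z1) - cdiff F i V y').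
      by rewrite germB (germ_res _ _ W1e) yE germ_d y'E -mulmxA dmx_idl subrr.
    rewrite oresB (ores_comp _ _ (osub_trans h h')) => /eqP.
    rewrite subr_eq0 -!ohom_nat => /eqP tz.
    have dz : cdiff G _ _ (ores (osub_trans h h') z1) = 0.
      by rewrite ohom_nat dz1 ores0.
    have [V2 [h2 [v [V2e zv]]]] := (te i).1 _ _ _ V'e dz tz.
    have k := osub_trans (osub_trans h h') h2.
    apply: (@j_neq0 _ i0 V2 (s i V2 v + ores k w) V2e).
    rewrite ohomD -chain_nat -zv (ores_comp _ _ k) !ohom_nat.
    by rewrite -oresD -jE (ores_comp _ _ (osubT V2)).
  have sz : s (i + 1) W1 z1 = cdiff J i W1 (- w).
    rewrite -[- w]sub0r ohomB ohom0 sub0r; apply/eqP; rewrite -addr_eq0 -jE.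
    by rewrite (j0 i0) ores0.
  have [V [h [v [Ve zv]]]] := (se i).1 _ _ _ W1e dz1 sz.
  rewrite -(germ_res _ h W1e Ve) -ohom_nat zv chain_nat germ_d.
  exact: submxMl.
move=> V Ve x dx.
have [V1 [l1 [z [y [V1e dz xE]]]]] := (te i).2 _ _ Ve dx.
have dsz : cdiff J _ _ (s _ _ z) = 0 by rewrite -chain_nat dz ohom0.
have [V2 [l2 [c [w2 [V2e szE]]]]] := j_gen V1e dsz.
pose V3 := opensI V2 W1.
pose k2 : osub V3 V2 := osubIl _ _; pose k1 : osub V3 W1 := osubIr _ _.
pose c' := rs_res k2 c.
pose u := ores (osub_trans l2 k2) z - c' *: ores k1 z1.
have V3e : oset V3 eta by split.
have du : cdiff G _ _ u = 0.
  by rewrite ohomB ohomZ !ohom_nat dz dz1 !ores0 scaler0 subrr.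
have su : s _ _ u = cdiff J _ _ (ores k2 w2 + c' *: ores k1 w).
  rewrite ohomB ohomZ !ohom_nat -(ores_comp l2 k2) szE oresD oresZ.
  rewrite (ores_comp _ _ (osubT V3)) -/c'.
  have -> : ores (osubT V3) (j (i + 1)) =
      ores k1 (s (i + 1) W1 z1) + ores k1 (cdiff J i W1 w).
    by rewrite -oresD -jE (ores_comp _ _ (osubT V3)).
  rewrite scalerDr ohomD ohomZ !ohom_nat [LHS]addrC !addrA addNr add0r.
  exact: addrC.
have [V4 [l4 [y4 [V4e uE]]]] := (se i).1 _ _ _ V3e du su.
exists (kap V3e c').
pose m2 := osub_trans (osub_trans l2 k2) l4; pose m1 := osub_trans k1 l4.
have tz : gm _ V1e (t _ _ z) = gm _ V4e (t _ _ (cdiff G i _ y4)) +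
    kap V3e c' *: gm _ W1e (t _ _ z1).
  rewrite -(germ_res _ m2 V1e V4e) -(germ_res _ m1 W1e V4e).
  rewrite -(kap_res l4 V3e V4e) -germZ -germD -!ohom_nat -ohomZ -ohomD -uE.
  rewrite oresB oresZ (ores_comp _ _ m2) (ores_comp _ _ m1).
  by rewrite subrK.
rewrite -(germ_res _ l1 Ve V1e) xE germD tz chain_nat !germ_d.
rewrite addrAC addrK; apply: addmx_sub; exact: submxMl.
Qed.

(** In degree 0, [P] is a projector onto the line spanned by [iota] that kills
    coboundaries, so it acts as the identity on cohomology; in other degrees it
    is zero.  Its trace is the contribution of each degree to the Euler
    characteristic of [F] at [eta]. *)
Lemma generator_projector i : exists P : 'M[K]_(n (i + 1)),
  [/\ P *m dmx (i + 1) = 0, dmx i *m P = 0, \tr P = (i + 1 == 0)%:R &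
   forall v : 'rV_(n (i + 1)), v *m dmx (i + 1) = 0 ->
     (v *m (E (i + 1) - P) <= dmx i)%MS].
Proof.
have [iota [iE iD iB class_iota]] := generator_class i.
have cocycle (v : 'rV_(n (i + 1))) : v *m dmx (i + 1) = 0 ->
    exists c, (v *m E (i + 1) - c *: iota <= dmx i)%MS.
  move=> /(cocycle_lift (I : oset (Opens openT) eta))[V [_ [Ve [x [<- dx]]]]].
  exact: class_iota.
have [i0|i0] := eqVneq (i + 1) 0; last first.
  exists 0; rewrite mul0mx mulmx0 mxtrace0; split=> // v vD.
  have [c vB] := cocycle v vD; rewrite subr0 -[v *m _](subrK (c *: iota)).
  by rewrite addmx_sub // scalemx_sub // iB.
(* A linear form [pi] vanishing on coboundaries with [pi iota = 1] is read off
   a column of the cokernel of [dmx i]. *)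
have [C DC [k ik]] : exists2 C : 'M_(n (i + 1)), dmx i *m C = 0 &
    exists k, (iota *m C) 0 k != 0.
  exists (cokermx (dmx i)); first exact: mulmx_coker.
  by apply/rV0Pn; rewrite -submxE iB i0 eqxx.
pose pi := ((iota *m C) 0 k)^-1 *: col k C.
have Dpi : dmx i *m pi = 0.
  by rewrite -scalemxAr colE mulmxA DC mul0mx scaler0.
have ipi : iota *m pi = 1%:M.
  rewrite -scalemxAr colE mulmxA -colE; apply/matrixP => x y.
  by rewrite !ord1 mxE [X in _ * X]mxE mulVf // mxE eqxx.
exists (E (i + 1) *m pi *m iota); split.
- by rewrite -mulmxA iD mulmx0.
- by rewrite !mulmxA dmx_idr Dpi mul0mx.
- by rewrite mxtrace_mulC mulmxA iE ipi mxtrace1.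
move=> v vD; have [c vB] := cocycle v vD.
have vEpi : v *m E (i + 1) *m pi = c%:M.
  have /submxP[y yE] := vB.
  rewrite -[v *m _](subrK (c *: iota)) yE mulmxDl -mulmxA Dpi mulmx0 add0r.
  by rewrite -scalemxAl ipi scale_scalar_mx mulr1.
by rewrite mulmxBr !mulmxA vEpi mul_scalar_mx.
Qed.

Lemma local_chain_succ W (B : complex X) (f : forall i, lhom W (F i) (B i)) :
  (forall i V (h : osub V W) x, f (i + 1 + 1) V h (cdiff F (i + 1) V x) =
     cdiff B (i + 1) V (f (i + 1) V h x)) -> local_chain f.
Proof. by move=> fC i; have := fC (i - 1); rewrite subrK. Qed.

(** With [g] a homotopy section of [t] and [h] a lift of [mu s g] through [s],
    the composite [t h] represents [mu], transported along the roof to [F]. *)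
Lemma homotopy_action : exists W (psi : forall i, lhom W (F i) (F i)),
  [/\ oset W p, local_chain psi &
   forall i V (h : osub V W) (Ve : oset V eta) x, cdiff F (i + 1) V x = 0 ->
     (gm (i + 1) Ve (psi (i + 1)%R V h x) - c0 *: gm (i + 1) Ve x <= dmx i)%MS].
Proof.
have idC : local_chain (fun i => lid (Opens openT) (F i)) by [].
have [W1 [h1 [g [k [W1p gE]]]]] := lift_along incK F_bounded tp idC I.
have gC : local_chain g by apply: local_chain_succ => i; have [] := gE i.
pose f i := lpost (mu i) (lpost (s i) (g i)).
have fC : local_chain f by move=> i V h x; rewrite /= gC !chain_nat.
have [W2 [h2 [h [k' [W2p hE]]]]] := lift_along incK F_bounded sp fC W1p.
have hC : local_chain h by apply: local_chain_succ => i; have [] := hE i.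
exists W2, (fun i => lpost (t i) (h i)); split=> //.
  by move=> i V l x; rewrite /= hC chain_nat.
move=> i V l Ve x dx /=.
pose V1 := opensI V U0; pose l1 : osub V1 V := osubIl _ _.
pose l2 : osub V1 W2 := osub_trans l l1.
pose a1 := rs_res (osubIr V U0 : osub V1 U0) a0.
have V1e : oset V1 eta by split.
pose x1 := ores l1 x.
have dx1 : cdiff F _ _ x1 = 0 by rewrite ohom_nat dx ores0.
pose gx := g (i + 1) V1 (osub_trans h2 l2) x1.
pose u := h (i + 1) V1 l2 x1 - a1 *: gx.
have du : cdiff G _ _ u = 0.
  by rewrite ohomB ohomZ -hC -gC dx1 !lfun0 scaler0 subrr.
have su : s _ _ u = cdiff J _ _ (k' i V1 l2 x1).
  have [_ /(_ V1 l2 x1)] := hE i.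
  rewrite dx1 lfun0 addr0 /= (muE (osubIr V U0 : osub V1 U0)) -/a1 => sh.
  by rewrite ohomB ohomZ sh addrAC subrr add0r.
have [V2 [l3 [y [V2e uE]]]] := (se i).1 _ _ _ V1e du su.
have tg : t _ _ gx = x1 + cdiff F _ _ (k i V1 (osub_trans h2 l2) x1).
  by have [_ ->] := gE i; rewrite dx1 lfun0 addr0.
rewrite -(germ_res _ l1 Ve V1e) -ohom_nat -(lfun_nat _ _ l2) -/x1.
rewrite -(germ_res _ l1 Ve V1e) -/x1.
have -> : gm _ V1e (t _ _ (h _ _ l2 x1)) = gm _ V2e (t _ _ (cdiff G i V2 y))
    + c0 *: gm _ V1e (t _ _ gx).
  rewrite -uE ohom_nat (germ_res _ _ V1e) ohomB ohomZ germB germZ.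
  by rewrite kap_res ?a0E // subrK.
rewrite tg germD scalerDr addrA [X in X - _]addrAC addrK.
rewrite chain_nat !germ_d.
by rewrite addmx_sub ?scalemx_sub ?submxMl.
Qed.

(** The supertrace of [psi] has the value [c0] at [eta]: [Psi - c0 P] acts as
    zero on cohomology, and the supertrace of [P] is the Euler characteristic of
    [F] at [eta], which is 1. *)
Lemma trace_section : exists W (tau : \O_X W),
  oset W p /\ forall We : oset W eta, kap We tau = c0.
Proof.
have [W [psi [Wp psiC psi_act]]] := homotopy_action.
have We := p_eta Wp.
pose Psi i : 'M[K]_(n i) := lmx (prj i) (inc i) We (psi i).
have PsiD i : Psi i *m dmx i = dmx i *m Psi (i + 1).
  apply/row_matrixP => k; rewrite !row_mul !rowK -germ_d -psiC.
  rewrite -(germ_res _ (osubT W) (I : oset (Opens openT) eta) We).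
  rewrite -(germ_lhom (@incK _) _ We (psi (i + 1)) (fun _ => id)).
  by rewrite /= ohom_nat ores_id.
pose P i := projT1 (cid (generator_projector i)).
have PP i := projT2 (cid (generator_projector i)).
(* Degrees are shifted by one, so that every index has the form [i + 1], in
   which cohomology is expressed. *)
pose Theta i : 'M[K]_(n (i + 1)) := Psi (i + 1) - c0 *: P i.
have ThetaD i : Theta i *m dmx (i + 1) = dmx (i + 1) *m Theta (i + 1).
  have [PD _ _ _] := PP i; have [_ DP _ _] := PP (i + 1).
  rewrite -/(P _) in PD DP.
  by rewrite mulmxBl mulmxBr PsiD -scalemxAl -scalemxAr PD DP !scaler0.
have Theta0 i (v : 'rV_(n (i + 1 + 1))) : v *m dmx (i + 1 + 1) = 0 ->
    (v *m Theta (i + 1)%R <= dmx (i + 1)%R)%MS.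
  move=> vD; have [_ _ _ /(_ v vD)] := PP (i + 1); rewrite -/(P _) => vP.
  have [V [h [Ve [x [xE dx]]]]] := cocycle_lift We vD.
  have := psi_act _ _ h Ve x dx.
  rewrite (germ_lhom (@incK _) _ We) xE -mulmxA lmx_idl => vPsi.
  have -> : v *m Theta (i + 1) = (v *m Psi (i + 1 + 1) - c0 *: (v *m E _))
      + c0 *: (v *m (E (i + 1 + 1) - P (i + 1))).
    by rewrite !mulmxBr scalerBr addrA subrK -scalemxAr.
  by rewrite addmx_sub // scalemx_sub.
(* [F] lives strictly between the degrees [- N] and [N]; the sum starts at
   degree [- N], so degree 0 occurs at [k = N], with sign [(-1) ^+ N]. *)
pose N := (`|a| + `|b|)%N.+1.
have [D0 DN] : dmx (- N.+2%:Z + 1) = 0 /\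
    dmx (- N.+2%:Z + (N.*2.+1)%:Z + 1) = 0.
  by split; apply: dmx_zero; lia.
have := alt_trace_null (fun i => dmxK (i + 1)) ThetaD Theta0 D0 DN.
have trT i : \tr (Theta i) = \tr (Psi (i + 1)) - c0 * (i + 1 == 0)%:R.
  by have [_ _ trP _] := PP i; rewrite mxtraceD raddfN /= mxtraceZ trP.
under eq_bigr => k _ do rewrite trT mulrBr.
rewrite sumrB => /subr0_eq.
have kN : (N < N.*2.+1)%N by lia.
rewrite [RHS](bigD1 (Ordinal kN)) //=.
rewrite [X in _ + X]big1 ?addr0 => [|k kk]; last first.
  have -> : (- N.+2%:Z + k%:Z + 1 + 1 == 0) = false; last by rewrite !mulr0.
  apply: contraNF kk => /eqP E0; apply/eqP/val_inj => /=; lia.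
have -> : - N.+2%:Z + N%:Z + 1 + 1 == 0 by lia.
rewrite mulr1 => trPsi.
pose psimx i : 'M[\O_X W]_(n i) := \matrix_k
  coords (inc i) (psi i W (fun _ => id) (ores (osubT W) (gen (prj i) k))).
have PsiE We' i : map_mx (kap We') (psimx i) = Psi i.
  apply/row_matrixP => k; rewrite -map_row !rowK (Prop_irrelevance We' We).
  by [].
exists W, ((-1) ^+ N * \sum_(k < N.*2.+1)
  (-1) ^+ k * \tr (psimx (- N.+2%:Z + k%:Z + 1 + 1))); split=> // We'.
rewrite rmorphM rmorph_sum rmorphXn rmorphN1 /=.
under eq_bigr => k _ do
  rewrite rmorphM rmorphXn rmorphN1 -trace_map_mx PsiE.
by rewrite trPsi signrMK.
Qed.

End Supertrace.
End GenericStalk.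

(** * Complexes restricted to an open set, single modules, scalars *)

Section RestrictChain.
Variables (X : ringedSpace) (U : opens X) (M N : complex X).

Definition restrict_chain (f : chainMap M N) :
    chainMap (restrict_complex U M) (restrict_complex U N) :=
  @ChainMap (rs_restrict U) (restrict_complex U M) (restrict_complex U N)
    (fun i => restrict_hom U (f i)) (fun i W x => chain_nat f x).

Lemma set_val_continuous : continuous (set_val : set_type U -> X).
Proof. exact: initial_continuous. Qed.

Lemma opre_val_sub (W : opens (set_type U)) (V : opens X) :
  osub V (oimg W) -> osub (opre set_val_continuous V) W.
Proof. by move=> VW x /VW[y Wy yx]; have <- : y = x by exact: val_inj. Qed.

Lemma oimg_opre_sub (V : opens X) : osub (oimg (opre set_val_continuous V)) V.
Proof. by move=> _ [x Vx <-]. Qed.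

Lemma restrict_quasi_iso_at (f : chainMap M N) (p : rs_restrict U) :
  quasi_iso_at f (val p) -> quasi_iso_at (restrict_chain f) p.
Proof.
move=> qf i; have [fi fs] := qf i; split.
  move=> W x y Wp dx fx; have iWp : oset (oimg W) (val p) by exists p.
  have [V [h [z [Vp xz]]]] := fi _ x y iWp dx fx.
  exists (opre set_val_continuous V), (opre_val_sub h).
  exists (ores (@oimg_opre_sub V) z); split=> //.
  apply: etrans (esym (ohom_nat (cdiff M i) _ _)).
  by rewrite -xz (ores_comp _ _ (oimg_sub (opre_val_sub h))).
move=> W y Wp dy; have iWp : oset (oimg W) (val p) by exists p.
have [V [h [x [z [Vp dx yE]]]]] := fs _ y iWp dy.
exists (opre set_val_continuous V), (opre_val_sub h).
exists (ores (@oimg_opre_sub V) x), (ores (@oimg_opre_sub V) z).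
split=> //.
  by apply: etrans (ohom_nat (cdiff M (i + 1)) _ _) _; rewrite dx ores0.
apply: etrans (esym (ores_comp h (@oimg_opre_sub V) _ _)) _.
rewrite yE oresD; congr (_ + _); exact/esym/ohom_nat.
Qed.

End RestrictChain.

Section SingleComplex.
Variable X : ringedSpace.

Lemma single_zero (F : omod X) (i : int) : i != 0 -> is_zero (single F i).
Proof. by case: i => [[|m]|m] // _ U x; apply/rowP => -[]. Qed.

(** The generator of the complex with the structure sheaf in degree 0. *)
Definition single_one (i : int) (U : opens X) : single (structure_mod X) i U :=
  match i with Posz 0 => 1 : \O_X U | _ => 0 end.

Lemma single_one_res i (U V : opens X) (h : osub V U) :
  ores h (single_one i U) = single_one i V.
Proof.
case: i => [[|m]|m]; [exact: rmorph1|exact: ores0|exact: ores0].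
Qed.

Lemma single_one_gen i (U : opens X) (x : single (structure_mod X) i U) :
  exists c, x = c *: single_one i U.
Proof.
have [i0|i0] := eqVneq i 0; last first.
  by exists 0; rewrite scale0r; exact: single_zero.
by move: x; rewrite i0 => x; exists x; exact/esym/mulr1.
Qed.

End SingleComplex.

Section ScalarChain.
Variables (X : ringedSpace) (c : \O_X (Opens openT)).

Section Module.
Variable M : omod X.
Let scale_fun (U : opens X) (x : M U) : M U := rs_res (osubT U) c *: x.

Fact scale_fun_linear U : linear (@scale_fun U).
Proof. by move=> a x y; rewrite /scale_fun scalerDr !scalerA mulrC. Qed.

HB.instance Definition _ U := GRing.isLinear.Build (\O_X U) (M U) (M U) _
  (@scale_fun U) (@scale_fun_linear U).

Fact scale_fun_nat U V (h : osub V U) (x : M U) :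
  scale_fun (ores h x) = ores h (scale_fun x).
Proof. by rewrite /scale_fun oresZ (rs_res_comp _ _ (osubT V)). Qed.

Definition scale_hom : ohom M M :=
  @OHom X M M (fun U => @scale_fun U) scale_fun_nat.

End Module.

Definition scale_chain (M : complex X) : chainMap M M :=
  @ChainMap X M M (fun i => scale_hom (M i))
    (fun i U x => esym (ohomZ (cdiff M i) _ x)).

End ScalarChain.

(** * Sections of the structure sheaf of a spectrum *)

Section Spec.
Variable R : idomainType.
Implicit Types (U V W : opens (spec R)) (p q : spec R).

Fact basic_open_subproof (t : R) : zariski_open [set p : spec R | t \notin p].
Proof.
exists [set t]; apply/seteqP; split=> p /= [].
  by move=> tp; exists t.
by move=> _ ->.
Qed.

Lemma basic_open_open (t : R) : open [set p : spec R | t \notin p].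
Proof. exact: basic_open_subproof. Qed.

Definition basic_open (t : R) : opens (spec R) := Opens (basic_open_open t).

Lemma open_basic U p : oset U p ->
  exists2 t, oset (basic_open t) p & osub (basic_open t) U.
Proof.
have [A UA] : zariski_open (oset U) := oopen U.
by rewrite /osub UA => -[t At tp]; exists t => // q tq; exists t.
Qed.

Lemma generic_open U p : oset U p -> oset U (spec_generic R).
Proof.
move=> /open_basic[t tp tU]; apply: tU; rewrite /= inE.
by apply: contraNneq tp => ->; have [] := spec_ideal p.
Qed.

Definition opt U p (Up : oset U p) : set_type U := SigSub (mem_set Up).

Definition spec_ev U p (Up : oset U p) (s : spec_sec U) : {fraction R} :=
  s (opt Up).

Lemma spec_ev_zmod U p (Up : oset U p) : zmod_morphism (spec_ev Up).
Proof. by []. Qed.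
Lemma spec_ev_monoid U p (Up : oset U p) : monoid_morphism (spec_ev Up).
Proof. by []. Qed.

HB.instance Definition _ U p (Up : oset U p) :=
  GRing.isZmodMorphism.Build (spec_sec U) {fraction R} (spec_ev Up)
    (spec_ev_zmod Up).
HB.instance Definition _ U p (Up : oset U p) :=
  GRing.isMonoidMorphism.Build (spec_sec U) {fraction R} (spec_ev Up)
    (spec_ev_monoid Up).

Lemma spec_ev_res U V (h : osub V U) p (Up : oset U p) (Vp : oset V p) s :
  spec_ev Vp (spec_res h s) = spec_ev Up s.
Proof. by congr (spec_val s _); exact: val_inj. Qed.

Lemma spec_sec_ext U (s t : spec_sec U) :
  (forall p (Up : oset U p), spec_ev Up s = spec_ev Up t) -> s = t.
Proof.
move=> st; apply: val_inj; apply/funext => x.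
have := st _ (set_valP x); rewrite /spec_ev.
have -> // : opt (set_valP x) = x by exact: val_inj.
Qed.

Lemma spec_ev_local U (s : spec_sec U) p : oset U p ->
  exists2 V, oset V p & exists a b, forall q (Uq : oset U q), oset V q ->
    b \notin q /\ spec_ev Uq s = a%:F / b%:F.
Proof.
move=> Up; have /asboolP/(_ (opt Up))[V Vp [a [b sV]]] := spec_valP s.
by exists V => //; exists a, b => q Uq; exact: (sV (opt Uq)).
Qed.

Fact frac_sec_regular U (a b : R) : (forall p, oset U p -> b \notin p) ->
  (fun _ : U => a%:F / b%:F) \in @regular R U.
Proof.
move=> bU; apply/asboolP => p; exists (Opens openT) => //; exists a, b => q _.
by split=> //; exact/bU/set_valP.
Qed.

Definition frac_sec U (a b : R) (bU : forall p, oset U p -> b \notin p) :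
  spec_sec U := SpecSec (frac_sec_regular a bU).

Lemma spec_ev_frac U a b (bU : forall p, oset U p -> b \notin p) p
  (Up : oset U p) : spec_ev Up (frac_sec a bU) = a%:F / b%:F.
Proof. by []. Qed.

Lemma spec_ev_eq0 U p (Up : oset U p) (s : spec_sec U) : spec_ev Up s = 0 ->
  exists V (h : osub V U), oset V p /\ spec_res h s = 0.
Proof.
move=> s0; have [V Vp [a [b sE]]] := spec_ev_local s Up.
have [bp] := sE p Up Vp; rewrite s0 => /esym/eqP; rewrite mulf_eq0 invr_eq0.
rewrite (negPf (spec_den_neq0 bp)) orbF => /eqP a0.
exists (opensI U V), (osubIl U V); split=> //.
apply: spec_sec_ext => q UVq; rewrite (spec_ev_res _ UVq.1).
by have [_ ->] := sE q UVq.1 UVq.2; rewrite a0 mul0r.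
Qed.

Lemma fracP (z : {fraction R}) : exists a b : R, b != 0 /\ z = a%:F / b%:F.
Proof.
elim/quotW: z => x; have x0 := denom_ratioP x.
exists (frac x).1, (frac x).2; split=> //.
suff E : \pi_({fraction R})%qT x * (frac x).2%:F = (frac x).1%:F.
  by rewrite -E mulfK // tofrac_eq0.
unlock FracField.tofrac; rewrite -[LHS]FracField.pi_mul /FracField.mulf.
rewrite !numden_Ratio ?oner_eq0 // mulr1.
apply/eqmodP; rewrite /= FracField.equivfE !numden_Ratio ?oner_eq0 //.
by rewrite mulr1 mulrC.
Qed.

End Spec.

(** * The unit at a point where the morphism is a local isomorphism *)

(** The hypothesis [phi_frac] says that every element of [S] is a fraction of
    elements of [R] with denominator outside [q].  With injectivity of [phi] it
    makes the local ring of Spec R at [p] equal to that of Spec S at [q]. *)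
Section LocalIso.
Variables (R S : idomainType) (phi : {rmorphism R -> S}).
Hypothesis phi_inj : injective phi.
Local Notation f := (Spec_map phi).
Variable q : spec S.
Local Notation p := (spec_comap phi q).
Hypothesis phi_frac : forall a : S,
  exists a' b', phi b' \notin q /\ phi b' * a = phi a'.

(** If [t] is the fraction [phi a' / phi b'], then [phi a'] vanishes wherever
    [t] does, so the basic open set of [t] contains the preimage of that of
    [a']. *)
Lemma open_fibre (V : opens (spec S)) : oset V q ->
  exists2 W : opens (spec R), oset W p & osub (opre (rs_cont f) W) V.
Proof.
move=> /open_basic[t tq tV]; have [a' [b' [bq E]]] := phi_frac t.
exists (basic_open a') => [|q' aq']; first by rewrite /= inE -E spec_notinM bq.
apply: tV; have : phi a' \notin q' by [].
by rewrite -E spec_notinM => /andP[].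
Qed.

Lemma spec_ev_sharp (U : opens (spec R)) q' (Uq : oset U (spec_comap phi q'))
    (Uq' : oset (opre (rs_cont f) U) q') (x : spec_sec U) :
  spec_ev Uq' (spec_sharp phi x) = local_map phi q' (spec_ev Uq x).
Proof.
rewrite /spec_ev /= /spec_sharp_fun; congr (local_map _ _ (x _)).
exact: val_inj.
Qed.

Lemma sharp_locally_injective (U : opens (spec R)) (x : spec_sec U)
    (V : opens (spec S)) (h : osub V (opre (rs_cont f) U)) :
  oset V q -> spec_res h (spec_sharp phi x) = 0 ->
  exists W (k : osub W U), oset W p /\ spec_res k x = 0.
Proof.
move=> Vq x0; have Up : oset U p := h _ Vq; apply: (@spec_ev_eq0 _ _ _ Up).
have := congr1 (spec_ev Vq) x0.
rewrite (spec_ev_res _ (h _ Vq)) (spec_ev_sharp Up) rmorph0.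
have [V' V'p [a [b /(_ p Up V'p)[bp ->]]]] := spec_ev_local x Up.
rewrite local_mapE // => /eqP; rewrite mulf_eq0 invr_eq0.
rewrite (negPf (spec_den_neq0 (bp : phi b \notin q))) orbF tofrac_eq0.
by rewrite -(rmorph0 phi) (inj_eq phi_inj) => /eqP->; rewrite tofrac0 mul0r.
Qed.

Lemma sharp_locally_surjective (V : opens (spec S)) (y : spec_sec V) :
  oset V q -> exists (W : opens (spec R)) (h : osub (opre (rs_cont f) W) V)
    (x : spec_sec W), oset W p /\ spec_res h y = spec_sharp phi x.
Proof.
move=> Vq; have [V' V'q [a [b yE]]] := spec_ev_local y Vq.
have [bq _] := yE q Vq V'q.
have [a1 [b1 [b1q aE]]] := phi_frac a; have [a2 [b2 [b2q bE]]] := phi_frac b.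
have [|W1 W1p W1V] := @open_fibre (opensI V V'); first by split.
pose W := opensI W1 (basic_open (b1 * a2)).
have Wden p' : oset W p' -> b1 * a2 \notin p' by case.
have h : osub (opre (rs_cont f) W) V by move=> q' [/W1V[]].
exists W, h, (frac_sec (a1 * b2) Wden); split.
  by split=> //=; rewrite inE rmorphM -bE !spec_notinM b1q b2q.
apply: spec_sec_ext => q' Wq'; rewrite (spec_ev_res _ (h _ Wq')).
have [/W1V[Vq' V'q'] Wq0] := Wq'.
have [bq' ->] := yE q' (h _ Wq') V'q'.
rewrite (spec_ev_sharp (Wq' : oset W (spec_comap phi q'))).
rewrite spec_ev_frac local_mapE //.
have d0 := spec_den_neq0 bq'.
have d1 := spec_den_neq0 (Wq0 : phi (b1 * a2) \notin q').
apply/eqP; rewrite eqr_div // -!tofracM tofrac_eq.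
by rewrite !rmorphM -aE -bE mulrA [a * _]mulrC mulrA.
Qed.

(** The map [O_X -> f_* O_Y] is bijective on germs, and cohomology of the
    push-forward of [I] near [p] is cohomology of [I] near [q], because the
    preimages of the neighbourhoods of [p] are cofinal among the neighbourhoods
    of [q]. *)
Lemma derived_unit_quasi_iso_at (I : complex (Spec_rs S))
    (r : chainMap (single (structure_mod (Spec_rs S))) I) :
  quasi_iso r -> quasi_iso_at (derived_unit f r) p.
Proof.
move=> /quasi_isoP/(_ q) qr i.
have [i0|i0] := eqVneq (i + 1) 0.
  have {i0}-> : i = -1 by lia.
  have [ri rs] := qr (-1); split.
    move=> U x y Up _ ux.
    have [V [h [z [Vq xz]]]] := ri _ (rs_sharp f U x) y Up erefl ux.
    have [W [k [Wp x0]]] := sharp_locally_injective Vq xz.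
    by exists W, k, 0.
  move=> U y Up dy.
  have [V [h [x [z [Vq _ yE]]]]] := rs _ y Up dy.
  have [W [k [x' [Wp xE]]]] := sharp_locally_surjective x Vq.
  have WU : osub (opensI W U) U := osubIr W U.
  pose k1 : osub (opre (rs_cont f) (opensI W U)) V :=
    osub_trans k (opre_sub (cf := rs_cont f) (osubIl W U)).
  exists (opensI W U), WU.
  exists (spec_res (osubIl W U) x'), (ores k1 z); split=> //.
  apply: etrans (esym (ores_comp h k1 _ _)) _.
  rewrite yE oresD; congr (_ + _); last exact/esym/ohom_nat.
  apply: etrans (esym (ohom_nat (r (-1 + 1)) _ _)) _.
  congr (r _ _ _).
  have := spec_sharp_nat phi (osubIl W U) x'; rewrite -xE => E.
  apply: etrans (esym E).
  exact/esym/(@ores_comp _ (structure_mod (Spec_rs S))).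
have [ri rs] := qr i; split.
  move=> U x y Up _ _; exists U, (fun _ => id), 0; split=> //.
  by rewrite (single_zero i0 x) ores0 ohom0.
move=> U y Up dy; have [V [h [x [z [Vq _ yE]]]]] := rs _ y Up dy.
have [W Wp WV] := open_fibre Vq.
pose k1 : osub (opre (rs_cont f) (opensI W U)) V :=
  osub_trans WV (opre_sub (cf := rs_cont f) (osubIl W U)).
exists (opensI W U), (osubIr W U), 0, (ores k1 z).
split=> //.
apply: etrans (esym (ores_comp h k1 _ _)) _.
rewrite ohom0 add0r yE (single_zero i0 x) ohom0 add0r; exact/esym/ohom_nat.
Qed.

End LocalIso.

(** * Proper ideals lie in primes *)

Section PrimeExistence.
Variable R : comNzRingType.

(** An ideal maximal among the proper ideals containing [I] is prime. *)
Lemma ideal_sub_prime (I : set R) : I 0 -> ~ I 1 ->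
  (forall a u v, I u -> I v -> I (a * u + v)) ->
  exists p : spec R, forall x, I x -> x \in p.
Proof.
move=> I0 I1 IC.
pose closed (A : set R) := forall a u v, A u -> A v -> A (a * u + v).
(* Zorn's lemma is applied to the sets [A] for which [A `|` I] is a proper
   ideal, as the union over an empty chain is empty rather than equal to [I]. *)
pose P A := closed (A `|` I) /\ ~ (A `|` I) 1.
have [C CP Ctot|A [[AC A1] Amax]] := @Zorn_bigcup _ P.
  split; last first.
    by move=> [[B CB B1]|//]; have [_] := CP B CB; apply; left.
  have in1 B x : C B -> B x -> (\bigcup_(X in C) X `|` I) x.
    by move=> CB Bx; left; exists B.
  have closedC B a u v : C B -> (B `|` I) u -> (B `|` I) v ->
      (\bigcup_(X in C) X `|` I) (a * u + v).
    move=> CB Bu Bv; have [/(_ a u v Bu Bv)[Bw|Iw] _] := CP B CB.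
      exact: (in1 B).
    by right.
  move=> a u v [[B CB Bu]|Iu] [[B' CB' Bv]|Iv].
  - have [BB'|B'B] := Ctot B B' CB CB'.
      by apply: (closedC B') => //; left; [exact: BB'|].
    by apply: (closedC B) => //; left; [|exact: B'B].
  - by apply: (closedC B) => //; [left|right].
  - by apply: (closedC B') => //; [right|left].
  - by right; exact: IC.
pose M := A `|` I.
have M0 : M 0 by right.
have MD u v : M u -> M v -> M (u + v).
  by move=> Mu Mv; rewrite -[u]mul1r; exact: AC.
have MM a u : M u -> M (a * u) by move=> Mu; rewrite -[a * u]addr0; exact: AC.
have Mid : idealr_closed (fun x => `[< M x >] : bool).
  split; rewrite ?unfold_in; [exact/asboolP|exact/asboolPn|] => a u v.
  by rewrite !unfold_in => /asboolP Mu /asboolP Mv; apply/asboolP; exact: AC.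
have Mpr : prime_idealr_closed (fun x => `[< M x >] : bool).
  move=> a b; rewrite !unfold_in => /asboolP Mab; apply/orP.
  have [Ma|Ma] := pselect (M a); first by left; apply/asboolP.
  right; apply/asboolP.
  pose B := [set x | exists r m, M m /\ x = r * a + m].
  have MB x : M x -> B x by move=> Mx; exists 0, x; rewrite mul0r add0r.
  have BI : B `|` I = B.
    by apply/seteqP; split=> x; [case=> // Ix; apply: MB; right|left].
  have [r [m [Mm E]]] : B 1.
    apply: contrapT => B1; apply: (Amax B); last first.
      rewrite /P BI; split=> // c u v [r [m [Mm ->]]] [r' [m' [Mm' ->]]].
      exists (c * r + r'), (c * m + m'); split; first exact: AC.
      by rewrite mulrDr mulrDl addrACA !mulrA.
    split=> [x Ax|BA]; first by apply: MB; left.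
    by apply: Ma; left; apply: BA; exists 1, 0; rewrite mul1r addr0.
  rewrite -[b]mul1r E mulrDl -mulrA [m * b]mulrC.
  by apply: MD; exact: MM.
by exists (Spec Mid Mpr) => x Ix; apply/asboolP; right.
Qed.

End PrimeExistence.

(** * Perfectness forces the ring extension to be trivial *)

Section Birational.
Variables (R S : idomainType) (phi : {rmorphism R -> S}).
Hypothesis birat_phi : birational phi.

Lemma birational_injective : injective phi.
Proof.
apply: raddf_inj => a /eqP a0.
have := congr1 (fun p : spec R => a \in p) birat_phi.1.
by rewrite /= !inE a0 => /esym/eqP.
Qed.

Lemma birational_frac (x : S) : exists a b, b != 0 /\ phi b * x = phi a.
Proof.
have [g _ gK] := birat_phi.2; have [a [b [b0 E]]] := fracP (g x%:F).
have bq : phi b \notin spec_generic S.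
  by rewrite inE -(rmorph0 phi) (inj_eq birational_injective).
exists a, b; split=> //; apply/eqP; rewrite -tofrac_eq tofracM.
have := gK x%:F; rewrite E local_mapE // => <-.
by rewrite mulrCA mulfV ?mulr1 // (spec_den_neq0 bq).
Qed.

Lemma generic_frac (x : S) :
  exists a b, phi b \notin spec_generic S /\ phi b * x = phi a.
Proof.
have [a [b [b0 E]]] := birational_frac x; exists a, b; split=> //.
by rewrite inE -(rmorph0 phi) (inj_eq birational_injective).
Qed.

Local Notation f := (Spec_map phi).
Variables (J : complex (Spec_rs S)).
Variable r : chainMap (single (structure_mod (Spec_rs S))) J.
Hypothesis qr : quasi_iso r.
Hypothesis perfJ : perfect (push_complex f J).

(** Near [p], the supertrace of multiplication by [x] is a section of the
    structure sheaf with generic value [x]; writing it as a fraction at [p]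
    shows that [x] belongs to the localization of [R] at [p]. *)
Lemma perfect_local_frac (x : S) (p : spec R) :
  exists a b, b \notin p /\ phi b * x = phi a.
Proof.
have [U Up [F [G [s [t [[[a [b Fb]] Fsum] /quasi_isoP qs /quasi_isoP qt]]]]]] :=
  perfJ p.
pose X' := rs_restrict U.
have Ue : oset U (spec_generic R) := generic_open Up.
pose eta : X' := opt Ue.
have Wimg (W : opens X') : oset W eta -> oset (oimg W) (spec_generic R).
  by move=> We; exists eta.
pose kap (W : opens X') (We : oset W eta) :
  {rmorphism \O_X' W -> {fraction R}} := spec_ev (Wimg W We).
have kap_res (W V : opens X') (h : osub V W) (We : oset W eta)
    (Ve : oset V eta) c : kap V Ve (rs_res h c) = kap W We c.
  exact: spec_ev_res.
have kap_lift (c : {fraction R}) (W : opens X') : oset W eta ->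
    exists V (_ : osub V W) (Ve : oset V eta) c', kap V Ve c' = c.
  move=> We; have [a1 [b1 [b0 ->]]] := fracP c.
  pose D := opre (@set_val_continuous (Spec_rs R) U) (basic_open b1).
  have De : oset (opensI W D) eta by split=> //; rewrite /= /preimage /= inE.
  have Dden q : oset (oimg (opensI W D)) q -> b1 \notin q.
    by move=> [y [_ Dy] <-].
  by exists (opensI W D), (osubIl W D), De, (frac_sec a1 Dden).
have kap_inj (W : opens X') (We : oset W eta) c : kap W We c = 0 ->
    exists V (h : osub V W), oset V eta /\ rs_res h c = 0.
  move=> /spec_ev_eq0[V [h [Ve c0]]].
  exists (opre (@set_val_continuous (Spec_rs R) U) V).
  exists (@opre_val_sub (Spec_rs R) U W V h); split=> //.
  apply: etrans (esym (@rs_res_comp (Spec_rs R) _ _ _ h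
    (@oimg_opre_sub (Spec_rs R) U V) _ _)) _.
  have -> : @rs_res (Spec_rs R) _ _ h c = 0 by exact: c0.
  exact: rmorph0.
have eta_open (W : opens X') : oset W (opt Up) -> oset W eta.
  move=> Wp; have [|y Wy yE] := @generic_open _ (oimg W) p.
    by exists (opt Up).
  by have <- : y = eta by exact: val_inj.
have unit_eta := derived_unit_quasi_iso_at birational_injective
  (q := spec_generic S) generic_frac qr.
rewrite birat_phi.1 in unit_eta.
have {}unit_eta := @restrict_quasi_iso_at (Spec_rs R) U _ _ _ eta unit_eta.
(* The classes spanning the cohomology of the push-forward at the generic point
   are the images of 1 under the unit. *)
pose j i : restrict_complex U (push_complex f J) i (Opens openT) :=
  derived_unit f r i _ (single_one i _).
have [a1 [b1 [b0 xE]]] := birational_frac x.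
have oneS (q : spec S) : oset (Opens openT) q -> 1 \notin q.
  by have [] := spec_ideal q.
pose xS : \O_(Spec_rs S) (Opens openT) := frac_sec x oneS.
pose mu := restrict_chain U (push_chain f (scale_chain xS J)).
(* Multiplication by [x = phi a1 / phi b1] agrees with multiplication by the
   section [a1 / b1] where [b1] does not vanish. *)
pose D : opens X' := opre (@set_val_continuous (Spec_rs R) U) (basic_open b1).
have De : oset D eta by rewrite /= /preimage /= inE.
have Dden q : oset (oimg D) q -> b1 \notin q by move=> [y Dy <-].
pose a0 : \O_X' D := frac_sec a1 Dden.
pose n i := projT1 (cid (Fsum i)).
pose inc i := projT1 (cid (projT2 (cid (Fsum i)))).
pose prj i := projT1 (cid (projT2 (cid (projT2 (cid (Fsum i)))))).
pose incK i := projT2 (cid (projT2 (cid (projT2 (cid (Fsum i)))))).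
have [||||||W [tau [Wp tauE]]] := @trace_section X' eta _ kap kap_res kap_lift
  kap_inj (opt Up) eta_open _ G F s t (qs _) (qs _) (qt _) (qt _) n inc prj incK
  a b Fb mu (a1%:F / b1%:F) D a0 De _ _ j.
- by [].
- move=> i V h y.
  have E : spec_res (osubT (opre (rs_cont f) (oimg V))) xS =
      spec_sharp phi (spec_res (oimg_sub h) a0).
    apply: spec_sec_ext => q Vq.
    rewrite (spec_ev_res _ (I : oset (Opens openT) q)).
    rewrite (spec_ev_sharp (Vq : oset (oimg V) (spec_comap phi q))).
    rewrite (spec_ev_res _ (oimg_sub h Vq)).
    rewrite !spec_ev_frac.
    have bq : phi b1 \notin q by exact: Dden (oimg_sub h Vq).
    rewrite local_mapE // tofrac1 divr1 -xE tofracM mulrAC mulfV ?mul1r //.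
    exact: spec_den_neq0 bq.
  pose V' : opens (Spec_rs S) := opre (rs_cont f) (oimg V).
  exact: (congr1 (fun z : \O_(Spec_rs S) V' => z *: (y : J i V')) E).
- move=> i; apply: etrans (esym (chain_nat (derived_unit f r) _)) _.
  exact: ohom0.
- move=> i i0; rewrite /j (single_zero i0 (single_one i _)).
  exact: (ohom0 (derived_unit f r i)).
- move=> i W y We dy.
  have [V [h [c' [w [Ve _ yE]]]]] := (unit_eta i).2 W y We dy.
  have [c cE] := @single_one_gen (Spec_rs R) (i + 1) (oimg V) c'.
  exists V, h, c, w; split=> //; rewrite yE cE; congr (_ + _).
  apply: etrans (ohomZ (derived_unit f r (i + 1)) c _) _.
  congr (c *: _); apply: etrans (ohom_nat (derived_unit f r (i + 1)) _ _).
  by congr (derived_unit f r _ _ _); rewrite single_one_res.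
- move=> i i0 W w We jw.
  have uw : restrict_chain U (derived_unit f r) (i + 1) W (single_one (i + 1) _)
      = cdiff (restrict_complex U (push_complex f J)) i W w.
    rewrite -jw; apply: etrans (ohom_nat (derived_unit f r (i + 1)) _ _).
    by congr (derived_unit f r _ _ _); rewrite single_one_res.
  have [V [h [z [Ve E]]]] := (unit_eta i).1 W _ w We erefl uw.
  have one0 : @single_one (Spec_rs R) (i + 1) (oimg V) = 0.
    by rewrite -(single_one_res _ (oimg_sub h)); exact: E.
  move: one0; rewrite i0 => /(congr1 (spec_ev (Wimg V Ve))).
  by rewrite rmorph1 rmorph0 => /eqP; rewrite oner_eq0.
(* A section has the same expression as a fraction at [p] and at the generic
   point, which lies in every neighbourhood of [p]. *)
have Wp' : oset (oimg W) p by exists (opt Up).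
have [V Vp [a2 [b2 tauV]]] := spec_ev_local tau Wp'.
have [b2p _] := tauV p Wp' Vp.
exists a2, b2; split=> //.
have We := eta_open W Wp.
have [b20 tau_eta] := tauV _ (Wimg W We) (generic_open Vp).
have := tauE We; rewrite [kap _ _ _]tau_eta => /eqP.
rewrite eqr_div ?tofrac_eq0 // -!tofracM tofrac_eq => /eqP ab.
have pb0 : phi b1 != 0 by rewrite -(rmorph0 phi) (inj_eq birational_injective).
by apply: (mulfI pb0); rewrite mulrCA xE -!rmorphM [b1 * a2]mulrC ab mulrC.
Qed.

(** The ideal of denominators of [x] is contained in no prime. *)
Lemma birational_perfect_surjective (x : S) : exists a, phi a = x.
Proof.
pose D : set R := [set b | exists a, phi b * x = phi a].
have [[a E]|D1] := pselect (D 1); first by exists a; rewrite -E rmorph1 mul1r.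
have [||p pD] := @ideal_sub_prime R D _ D1.
- by exists 0; rewrite !rmorph0 mul0r.
- move=> a u v [u' uE] [v' vE]; exists (a * u' + v').
  by rewrite !rmorphD !rmorphM mulrDl -mulrA uE vE.
have [a [b [bp E]]] := perfect_local_frac x p.
by move: bp; rewrite pD //; exists a.
Qed.

End Birational.

Section Isomorphism.
Variables (R S : idomainType) (phi : {rmorphism R -> S}).
Hypotheses (phi_inj : injective phi) (phi_surj : forall x, exists a, phi a = x).

Lemma spec_ext (p q : spec R) : (forall a, (a \in p) = (a \in q)) -> p = q.
Proof.
case: p q => [P idP prP] [Q idQ prQ] /= PQ.
have E : P = Q by apply/funext => a; exact: PQ.
by case: _ / E idQ prQ {PQ} => idQ prQ; congr Spec; exact: Prop_irrelevance.
Qed.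

Lemma spec_comap_surjective (p : spec R) : exists q, spec_comap phi q = p.
Proof.
have [g gK] := choice phi_surj.
have Kg : cancel phi g by move=> a; apply: phi_inj; rewrite gK.
have [p0 p1 pD] := spec_ideal p.
have qI : idealr_closed [pred x | g x \in p].
  have g0 : g 0 = 0 by rewrite -(rmorph0 phi) Kg.
  have g1 : g 1 = 1 by rewrite -(rmorph1 phi) Kg.
  split; rewrite ?inE ?g0 ?g1 // => a u v; rewrite !inE => up vp.
  have -> : g (a * u + v) = g a * g u + g v.
    by apply: phi_inj; rewrite rmorphD rmorphM !gK.
  exact: pD.
have qP : prime_idealr_closed [pred x | g x \in p].
  move=> u v; rewrite !inE.
  have -> : g (u * v) = g u * g v by apply: phi_inj; rewrite rmorphM !gK.
  exact: spec_prime.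
by exists (Spec qI qP); apply: spec_ext => a; rewrite /= !inE Kg.
Qed.
End Isomorphism.

Theorem lemma5p3 (R S : idomainType) (phi : {rmorphism R -> S})
    (noethR : noetherian R) (noethS : noetherian S)
    (fin_phi : finite_morphism phi) (birat_phi : birational phi)
    (I : complex (Spec_rs S))
    (r : chainMap (single (structure_mod (Spec_rs S))) I)
    (res_r : injective_resolution r) :
  perfect (push_complex (Spec_map phi) I) ->
  quasi_iso (derived_unit (Spec_map phi) r).
Proof.
have [qr _ _] := res_r => perfI.
have phi_inj := birational_injective birat_phi.
have surj := birational_perfect_surjective birat_phi qr perfI.
apply/quasi_isoP => p; have [q <-] := spec_comap_surjective phi_inj surj p.
apply: derived_unit_quasi_iso_at => // x; have [a <-] := surj x.
exists a, 1; rewrite rmorph1 mul1r; split=> //.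
by have [] := spec_ideal q.
Qed.
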